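(* Let $\mathcal{H}$ be a complex Hilbert space. For an operator $T\in\mathcal{B}(\mathcal{H})$ the following statements hold: (i) $T$ is concave if and only if $T$ has an extension $T_1$ on a Hilbert space $\mathcal{M}=\mathcal{M}_0\oplus\mathcal{M}_1\supset\mathcal{H}$ of the form $$T_1=\begin{pmatrix}V&\delta E_1\\0&W\end{pmatrix},$$ where $V\in\mathcal{B}(\mathcal{M}_0)$ and $W\in\mathcal{B}(\mathcal{M}_1)$ are isometries, $E_1\in\mathcal{B}(\mathcal{M}_1,\mathcal{M}_0)$ is a contraction with $V^*E_1=0$, $W^*E_1^*E_1W\le E_1^*E_1$, and $\delta=\|\Delta_T\|^{1/2}$. In this case $T_1$ is also concave with $\|\Delta_{T_1}\|^{1/2}=\delta$. (ii) If $T$ is concave, then the extension $T_1$ of $T$ provided by (i) can be taken such that: if one of the sequences $\{\Delta_T^{1/2}T^n\}$ or $\{\Delta_{T_1}^{1/2}T_1^n\}$ converges strongly to zero, then the other also converges strongly to zero, and in this case the sequences $\{\frac{1}{\sqrt n}T^n\}$ and $\{\frac1{\sqrt n}T_1^n\}$ converge strongly to zero. (iii) If $T$ is concave, then $T$ has a minimal $2$-isometric lifting of type I and of covariance $\|\Delta_T\|^{1/2}$.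
   Context: All Hilbert spaces are complex and operators are bounded and linear. $\Delta_T=T^*T-I$. $T$ is concave if $T^{*2}T^2-2T^*T+I\le0$, i.e. $\|T^2x\|^2-2\|Tx\|^2+\|x\|^2\le0$ for all $x$; a concave operator satisfies $\Delta_T\ge0$. $S$ is a $2$-isometry if $S^{*2}S^2-2S^*S+I=0$, and then its covariance is ${\rm cov}(S)=\|\Delta_S\|^{1/2}$. $T_1$ on $\mathcal{M}$ is an extension of $T$ if $T_1\mathcal{H}\subset\mathcal{H}$ and $T_1|_{\mathcal{H}}=T$, where $\mathcal{H}$ is identified with a closed subspace of $\mathcal{M}$ through an isometric embedding. If $\mathcal{H}$ is a closed subspace of $\mathcal{K}$, $S\in\mathcal{B}(\mathcal{K})$ is a lifting of $T\in\mathcal{B}(\mathcal{H})$ if $P_{\mathcal{H}}S=TP_{\mathcal{H}}$; it is minimal if $\mathcal{K}=\bigvee_{n\ge0}S^n\mathcal{H}$. A $2$-isometric lifting $S$ of $T$ is of type I if $\mathcal{K}\ominus\mathcal{H}\subset\mathcal{N}(\Delta_S)$ (equivalently, $S|_{\mathcal{K}\ominus\mathcal{H}}$ is an isometry). *)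

(* Defs.v *)
From HB Require Import structures.
From mathcomp Require Import all_boot all_order all_algebra.
From mathcomp Require Import complex.
From mathcomp Require Import all_classical all_reals all_analysis.

Set Implicit Arguments.
Unset Strict Implicit.
Unset Printing Implicit Defensive.

Import Order.TTheory GRing.Theory Num.Theory.
Import numFieldNormedType.Exports.

Local Open Scope classical_set_scope.
Local Open Scope complex_scope.
Local Open Scope ring_scope.

(* Complex Hilbert spaces: the scalars are R[i] for a realType R. The inner
   product is linear in its first argument and conjugate-linear in the second.
   As everywhere in normedtype, norms take their values in the scalars R[i];
   x <= y in R[i] means that y - x is a nonnegative real. *)
HB.mixin Record isHilbert (R : realType) H of CompleteNormedModule R[i] H := {
  inner : {dot H for @Num.conj R[i]} ;
  inner_norm : forall x : H, inner x x = `|x| ^+ 2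
}.

#[short(type="hilbertType")]
HB.structure Definition Hilbert (R : realType) :=
  { H of CompleteNormedModule R[i] H & isHilbert R H }.

Notation "''[' x , y ]" := (inner x y)
  (at level 0, format "''[' x ,  y ]") : ring_scope.

(* For a linear map, boundedness is continuity (linear_bounded_continuous). *)
Record boundedOp (R : realType) (H K : hilbertType R) := BoundedOp {
  bop :> {linear H -> K} ;
  bop_continuous : continuous bop
}.

Notation "''B' ( H , K )" := (boundedOp H K)
  (at level 8, format "''B' ( H ,  K )") : type_scope.
Notation "''B' ( H )" := (boundedOp H H)
  (at level 8, format "''B' ( H )") : type_scope.

Section Operators.
Variable R : realType.
Implicit Types H K M : hilbertType R.

(* T^* y is the vector z such that <T x, y> = <x, z> for all x, which exists
   and is unique when T is linear and bounded (Riesz). *)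
Definition adjoint H K (T : H -> K) (y : K) : H :=
  get [set z : H | forall x : H, '[T x, y] = '[x, z]].

Definition opnorm H K (A : H -> K) : R :=
  sup [set complex.Re `|A x| | x in [set x : H | `|x| <= 1]].

Definition ople H (A B : H -> H) : Prop :=
  forall x : H, '[A x, x] <= '[B x, x].

Definition Delta H (T : H -> H) (x : H) : H := adjoint T (T x) - x.

(* The positive square root A^(1/2) of a bounded positive operator A: the unique
   bounded positive operator whose square is A. *)
Definition psqrt H (A : H -> H) : H -> H :=
  get [set B : H -> H | [/\ linear B, continuous B, ople (fun=> 0) B
                          & forall x, B (B x) = A x]].

(* T^*^2 T^2 - 2 T^* T + I *)
Definition second_defect H (T : H -> H) (x : H) : H :=
  adjoint T (adjoint T (T (T x))) - adjoint T (T x) *+ 2 + x.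

Definition concave H (T : H -> H) : Prop := ople (second_defect T) (fun=> 0).

Definition two_isometry H (T : H -> H) : Prop :=
  forall x, second_defect T x = 0.

(* When T is a 2-isometry, this is the covariance of T. *)
Definition sqrt_norm_Delta H (T : H -> H) : R := Num.sqrt (opnorm (Delta T)).

Definition isometric H K (J : H -> K) : Prop :=
  isometry (@inner R K) (@inner R H) J.

Definition contractive H K (A : H -> K) : Prop := opnorm A <= 1.

(* H is identified with a closed subspace of M through the isometry J. *)
Definition extension H M (J : 'B(H, M)) (T : 'B(H)) (T1 : 'B(M)) : Prop :=
  isometric J /\ forall h, T1 (J h) = J (T h).

(* M is the orthogonal sum of M0 and M1, identified with closed subspaces of M
   through the isometries J0 and J1. *)
Definition orthogonal_sum M0 M1 M (J0 : 'B(M0, M)) (J1 : 'B(M1, M)) : Prop :=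
  [/\ isometric J0, isometric J1, forall x y, '[J0 x, J1 y] = 0
    & forall z, exists x y, z = J0 x + J1 y].

(* T1 is an extension of T that has, for some decomposition M = M0 (+) M1,
   the matrix
     / V  delta E1 \
     \ 0     W     /     with delta = || Delta T ||^(1/2). *)
Definition triangular_extension H M (J : 'B(H, M)) (T : 'B(H)) (T1 : 'B(M))
    : Prop :=
  extension J T T1 /\
  exists (M0 M1 : hilbertType R) (J0 : 'B(M0, M)) (J1 : 'B(M1, M))
         (V : 'B(M0)) (E1 : 'B(M1, M0)) (W : 'B(M1)),
    orthogonal_sum J0 J1 /\
    (forall x y, T1 (J0 x + J1 y) =
       J0 (V x + (sqrt_norm_Delta T)%:C *: E1 y) + J1 (W y)) /\
    [/\ isometric V, isometric W, contractive E1,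
        forall y, adjoint V (E1 y) = 0
      & ople (fun y => adjoint W (adjoint E1 (E1 (W y))))
             (fun y => adjoint E1 (E1 y))].

Definition strongly_cvg0 H K (A : nat -> H -> K) : Prop :=
  forall x : H, A n x @[n --> \oo] --> (0 : K).

Definition Delta_sqrt_iter H (T : H -> H) (n : nat) (x : H) : H :=
  psqrt (Delta T) (iter n T x).

(* The (irrelevant) value at n = 0 is 0. *)
Definition scaled_iter H (T : H -> H) (n : nat) (x : H) : H :=
  (sqrtC n%:R)^-1 *: iter n T x.

(* With H identified with J H, the orthogonal projection of K onto H is J^*. *)
Definition lifting H K (J : 'B(H, K)) (T : 'B(H)) (S : 'B(K)) : Prop :=
  isometric J /\ forall x, adjoint J (S x) = T (adjoint J x).

Definition closed_subspace K (F : set K) : Prop :=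
  [/\ closed F, F 0 & forall (a : R[i]) x y, F x -> F y -> F (a *: x + y)].

(* K is the closed linear span of the subspaces S^n H. *)
Definition minimal_lifting H K (J : 'B(H, K)) (S : 'B(K)) : Prop :=
  smallest (@closed_subspace K)
    (\bigcup_n range (fun h : H => iter n S (J h))) = [set: K].

Definition type_I H K (J : 'B(H, K)) (S : 'B(K)) : Prop :=
  forall x, (forall h, '[x, J h] = 0) -> Delta S x = 0.

End Operators.

(* Main.v *)
Require Import Defs.
From HB Require Import structures.
From mathcomp Require Import all_boot all_order all_algebra.
From mathcomp Require Import complex.
From mathcomp Require Import all_classical all_reals all_analysis.
From mathcomp Require Import ring lra.

(** Write D for T^*T - I, d for its norm and delta for d^(1/2). Concavity of T
    says that T^*DT <= D; since the increments |T^(n+1) x|^2 - |T^n x|^2 then decrease, they can never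
    be negative, so that D >= 0 and T is expansive.

    All three parts rest on one operator Q, with 0 <= Q <= I, T^*QT = Q and
    D <= d Q ([concave_majorant]). It is the limit of an increasing sequence that
    starts from D / d. The step is that any X <= I with T^*XT <= X can be enlarged
    to some X' <= I with T^*X'T = X ([majorant_step]): on the range of T the form
    of X' is prescribed, the prescribed values stay below the identity because T
    is expansive, and a factorization through (I - X)^(1/2) extends the form to
    the whole space. Then X' is again a competitor, and in the limit the
    inequality T^*XT <= X has become an equality.

    For the lifting, let Y = (d Q - D)^(1/2) and, on H + H + H + ... , let
    S (h, k0, k1, ...) = (T h, Y h, k0, k1, ...). Then S^*S - I is d Q on the first
    summand and 0 on the others, so the invariance of Q under T says exactly that
    S is a 2-isometry of type I. Minimality is obtained by restricting S to the
    closed span of the orbits of H ([concave_lifting]).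

    For the extension, embed H in M0 + M1 by h |-> ((I - Q)^(1/2) h, Q^(1/2) h).
    The invariance of Q gives a contraction G with G Q^(1/2) = Q^(1/2) T that is
    isometric on the range of Q^(1/2), and W is an isometric dilation of G. The
    bound D <= d Q gives a contraction E0 with delta E0 Q^(1/2) = D^(1/2). Finally
    ((I - Q)^(1/2) h, D^(1/2) h) |-> (I - Q)^(1/2) T h preserves norms, and an
    isometric dilation of this row contraction contains both V and an isometry
    whose range is orthogonal to that of V; composed with E0 it is E1
    ([triangular_model]). Conversely, for a triangular operator T1 the operator
    T1^*T1 - I is delta^2 E1^*E1 on M1 and 0 on M0, which yields the concavity of
    T1 and the value of the norm ([triangular_extension_concave]).

    The norm of (T^*T - I)^(1/2) T^n x squared is |T^(n+1) x|^2 - |T^n x|^2, so its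
    convergence to 0 makes |T^n x|^2 / n converge to 0 by Cesaro's lemma. For T1
    the same quantity is delta^2 |E1 W^n y|^2, which is controlled by its values
    for y in the range of Q^(1/2), that is by T.

    The constructions need closed subspaces, finite direct sums and spaces of
    square-summable sequences; they are all instances of one construction
    ([hilbert_data]). Estimates are made on the real part of the inner product,
    which is a real inner product with the same norm. *)

Set Implicit Arguments.
Unset Strict Implicit.
Unset Printing Implicit Defensive.

Import Order.TTheory GRing.Theory Num.Theory.
Import numFieldNormedType.Exports.

Local Open Scope classical_set_scope.
Local Open Scope complex_scope.
Local Open Scope ring_scope.

(** * Real part of a complex inner product *)

Lemma normRe (R : realType) (V : normedZmodType R[i]) (v : V) :
  `|v| = (complex.Re `|v|)%:C.
Proof. by have := normr_ge0 v; rewrite lecE; case: `|v| => a b /= /andP[/eqP->]. Qed.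

Lemma Re_norm_ge0 (R : realType) (V : normedZmodType R[i]) (v : V) :
  0 <= complex.Re `|v|.
Proof. by have := normr_ge0 v; rewrite lecE => /andP[]. Qed.

Section ComplexParts.
Variable R : realType.
Implicit Types a b : R[i].

Lemma cReD a b : complex.Re (a + b) = complex.Re a + complex.Re b.
Proof. by case: a b => [? ?] [? ?]. Qed.

Lemma cImD a b : complex.Im (a + b) = complex.Im a + complex.Im b.
Proof. by case: a b => [? ?] [? ?]. Qed.

Lemma cReN a : complex.Re (- a) = - complex.Re a.
Proof. by case: a. Qed.

Lemma cReM a b : complex.Re (a * b) =
  complex.Re a * complex.Re b - complex.Im a * complex.Im b.
Proof. by case: a b => [? ?] [? ?]. Qed.

Lemma cImM a b : complex.Im (a * b) =
  complex.Re a * complex.Im b + complex.Im a * complex.Re b.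
Proof. by case: a b => [? ?] [? ?]. Qed.

End ComplexParts.

Section RealPart.
Variables (R : realType) (U : lmodType R[i]) (f : {dot U for @Num.conj R[i]}).
Implicit Types (x y z : U) (c : R).

(** The real part determines the form, and its values live in an ordered field
    to which real arithmetic applies. *)
Definition redot x y : R := complex.Re (f x y).

Lemma redotDl x y z : redot (x + y) z = redot x z + redot y z.
Proof. by rewrite /redot linearDl cReD. Qed.

Lemma redotC x y : redot x y = redot y x.
Proof.
have := hermC f x y; rewrite /= expr0 mul1r /redot => ->.
by case: (f y x).
Qed.

Lemma redotDr x y z : redot x (y + z) = redot x y + redot x z.
Proof. by rewrite redotC redotDl (redotC y) (redotC z). Qed.

Lemma redotNl x z : redot (- x) z = - redot x z.
Proof. by rewrite /redot linearNl cReN. Qed.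

Lemma redotNr x z : redot z (- x) = - redot z x.
Proof. by rewrite redotC redotNl redotC. Qed.

Lemma redotZl c x z : redot (c%:C *: x) z = c * redot x z.
Proof. by rewrite /redot linearZl_LR cReM /= mul0r subr0. Qed.

Lemma redotZr c x z : redot x (c%:C *: z) = c * redot x z.
Proof. by rewrite redotC redotZl redotC. Qed.

Lemma redot0l x : redot 0 x = 0.
Proof. by rewrite /redot linear0l. Qed.

Lemma redot0r x : redot x 0 = 0.
Proof. by rewrite redotC redot0l. Qed.

Definition redotE := (redotDl, redotDr, redotNl, redotNr, redotZl, redotZr,
                      redot0l, redot0r).

Lemma dot_redot x y : f x y = redot x y +i* redot x ('i *: y).
Proof.
rewrite /redot linearZr_LR /= cReM; case: (f x y) => a b /=.
by congr (_ +i* _); rewrite mul0r sub0r mulNr opprK mul1r.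
Qed.

Lemma dotxx x : f x x = (redot x x)%:C.
Proof.
by have := dnorm_ge0 f x; rewrite /redot lecE => /andP[/eqP]; case: (f x x) => a b /= ->.
Qed.

Lemma redot_ge0 x : 0 <= redot x x.
Proof. by rewrite -ler0c -dotxx dnorm_ge0. Qed.

Lemma redot_eq0 x : redot x x = 0 -> x = 0.
Proof. by move=> x0; apply/eqP; rewrite -(dnorm_eq0 f) dotxx x0. Qed.

Lemma redotxxZ (a : R[i]) x :
  redot (a *: x) (a *: x) = complex.Re `|a| ^+ 2 * redot x x.
Proof.
have := dnormZ f a x; rewrite !dotxx normRe -rmorphXn -rmorphM.
by move=> /complexI.
Qed.

Lemma redot_CS x y : redot x y ^+ 2 <= redot x x * redot y y.
Proof.
have := redot_ge0 ((redot y y)%:C *: x - (redot x y)%:C *: y).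
have [y0 _|y0] := eqVneq (redot y y) 0.
  by rewrite (redot_eq0 y0) !redot0r; lra.
rewrite !redotE (redotC y x).
have yp : 0 < redot y y by rewrite lt_def y0 redot_ge0.
move: (redot x y) (redot x x) (redot y y) yp => p q r r0 h.
rewrite -subr_ge0 -(pmulr_rge0 _ r0); move: h; lra.
Qed.

Lemma redot_triangle x y :
  Num.sqrt (redot (x + y) (x + y)) <= Num.sqrt (redot x x) + Num.sqrt (redot y y).
Proof.
rewrite -(ler_pXn2r (n := 2)) ?nnegrE ?addr_ge0 ?sqrtr_ge0//.
rewrite sqrrD !sqr_sqrtr ?redot_ge0// !redotE (redotC y x).
have : redot x y <= Num.sqrt (redot x x) * Num.sqrt (redot y y).
  rewrite -sqrtrM ?redot_ge0// (le_trans (ler_norm _))//.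
  by rewrite -sqrtr_sqr ler_wsqrtr// redot_CS.
by lra.
Qed.

End RealPart.

(** * Hilbert spaces from inner product data *)

(** The carrier is a linear subset of an ambient module, so that closed subspaces,
    sums and sequence spaces inherit their algebra. The axioms of the inner product
    are only asked on this subset: for sequences the defining series diverges
    elsewhere. *)
Record hilbert_data (R : realType) := HilbertData {
  ambient : lmodType R[i];
  dom : set ambient;
  ip : ambient -> ambient -> R[i];
  dom0 : dom 0;
  domP : forall a x y, dom x -> dom y -> dom (a *: x + y);
  ipP : forall a x y z, dom x -> dom y -> dom z ->
    ip (a *: x + y) z = a * ip x z + ip y z;
  ipC : forall x y, dom x -> dom y -> ip x y = Num.conj (ip y x);
  ip_gt0 : forall x, dom x -> x != 0 -> 0 < ip x x;
  ip_complete : forall u : nat -> ambient, (forall n, dom (u n)) ->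
    (forall e : R, 0 < e -> exists N, forall m n, (N <= m)%N -> (N <= n)%N ->
       complex.Re (ip (u m - u n) (u m - u n)) < e) ->
    exists2 l, dom l & forall e : R, 0 < e -> exists N, forall n, (N <= n)%N ->
       complex.Re (ip (u n - l) (u n - l)) < e
}.

Section HilbertOf.
Variables (R : realType) (D : hilbert_data R).

Definition domain : {pred ambient D} := fun x => `[< dom x >].

Record hilbert_of : Type := HilbertOf { hval : ambient D; _ : hval \in domain }.

Lemma domain_submod : submod_closed domain.
Proof.
split; first by apply/asboolP; exact: dom0.
by move=> a x y /asboolP dx /asboolP dy; apply/asboolP; exact: domP.
Qed.

HB.instance Definition _ := [isSub for hval].
HB.instance Definition _ := [Choice of hilbert_of by <:].
HB.instance Definition _ := GRing.isSubmodClosed.Build _ _ domain domain_submod.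
HB.instance Definition _ := [SubChoice_isSubLmodule of hilbert_of by <:].

Lemma hvalP (x : hilbert_of) : dom (hval x).
Proof. by case: x => x /= /asboolP. Qed.

Definition hmk (x : ambient D) (dx : dom x) : hilbert_of :=
  HilbertOf (introT (asboolP _) dx : x \in domain).

Definition hip (x y : hilbert_of) : R[i] := ip (hval x) (hval y).

Lemma hip_bilinear : bilinear_for (GRing.Scale.Law.clone _ _ *%R _)
  (GRing.Scale.Law.clone _ _ (@Num.conj R[i] \; *%R) _) hip.
Proof.
have lin a x y z : hip (a *: x + y) z = a * hip x z + hip y z.
  by rewrite /hip /= ipP//; exact: hvalP.
split=> [z a x y|x a y z] /=; first exact: lin.
rewrite /hip ipC ?lin; try exact: hvalP.
rewrite -/(hip _ _) lin rmorphD rmorphM.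
by congr (_ * _ + _); rewrite /hip [RHS]ipC//; exact: hvalP.
Qed.

HB.instance Definition _ := bilinear_isBilinear.Build R[i] hilbert_of hilbert_of
  R[i] _ _ hip hip_bilinear.

Lemma hip_hermitian x y : hip x y = (-1) ^+ false * Num.conj (hip y x).
Proof. by rewrite expr0 mul1r /hip ipC//; exact: hvalP. Qed.

HB.instance Definition _ := isHermitianSesquilinear.Build R[i] hilbert_of false
  (@Num.conj R[i]) hip hip_hermitian.

Lemma hip_gt0 x : x != 0 -> 0 < hip x x.
Proof. by move=> x0; apply: ip_gt0; [exact: hvalP | exact: x0]. Qed.

HB.instance Definition _ := isDotProduct.Build R[i] hilbert_of hip hip_gt0.

Definition hnorm (x : hilbert_of) : R[i] := (Num.sqrt (redot hip x x))%:C.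

Lemma hnormD x y : hnorm (x + y) <= hnorm x + hnorm y.
Proof. by rewrite /hnorm -rmorphD lecR; exact: redot_triangle. Qed.

Lemma hnormZ a x : hnorm (a *: x) = `|a| * hnorm x.
Proof.
rewrite /hnorm redotxxZ sqrtrM ?exprn_ge0 ?Re_norm_ge0//.
by rewrite sqrtr_sqr ger0_norm ?Re_norm_ge0// [in RHS](normRe a) -rmorphM.
Qed.

Lemma hnorm_eq0 x : hnorm x = 0 -> x = 0.
Proof.
move=> /complexI /eqP; rewrite sqrtr_eq0 => x0.
by apply: (@redot_eq0 _ _ hip); apply/eqP; rewrite eq_le x0 redot_ge0.
Qed.

HB.instance Definition _ :=
  Lmodule_isNormed.Build R[i] hilbert_of hnormD hnormZ hnorm_eq0.

End HilbertOf.

Arguments hval {R D} _.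

Lemma natSinv_lt (R : archiRealFieldType) (e : R) : 0 < e ->
  exists N, forall n, (N <= n)%N -> n.+1%:R^-1 < e.
Proof. by move=> e0; have [N _ HN] := near_infty_natSinv_lt (PosNum e0); exists N. Qed.

Section Complete.
Variables (R : realType) (D : hilbert_data R).
Implicit Types x y : hilbert_of D.

Lemma hnorm_lt x y (e : R) : 0 <= e ->
  (`|x - y| < e%:C) = (redot (@hip R D) (x - y) (x - y) < e ^+ 2).
Proof.
move=> e0; rewrite ltcR -[in RHS](sqr_sqrtr (redot_ge0 _ (x - y))).
by rewrite ltr_pXn2r// nnegrE sqrtr_ge0.
Qed.

(** A Cauchy filter is followed by a sequence of centers of small balls that belong
    to it. *)
Lemma hilbert_of_complete (F : set_system (hilbert_of D)) :
  ProperFilter F -> cauchy F -> cvg F.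
Proof.
move=> FF /cauchyP Fc.
have /choice[u uP] : forall n, exists x, F (ball x (n.+1%:R^-1 : R)%:C).
  by move=> n; apply: Fc; rewrite ltcR invr_gt0 ltr0n.
have half (e : R) : 0 < e -> exists N, forall n, (N <= n)%N -> n.+1%:R^-1 < e / 2.
  by move=> e0; apply: natSinv_lt; rewrite divr_gt0.
have [||l dl ul] := ip_complete (u := hval \o u); first by move=> n; exact: hvalP.
  move=> e e0; have [|N HN] := half (Num.sqrt e); first by rewrite sqrtr_gt0.
  exists N => m n Nm Nn.
  have [z [zm zn]] := filter_ex (filterI (uP m) (uP n)).
  have : `|u m - u n| < (Num.sqrt e)%:C.
    rewrite [Num.sqrt e]splitr rmorphD.
    have -> : u m - u n = (u m - z) + (z - u n) by rewrite addrA subrK.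
    apply: (le_lt_trans (ler_normD _ _)); apply: ltrD.
      by move: zm; rewrite -ball_normE /= => /lt_trans; apply; rewrite ltcR HN.
    rewrite distrC.
    by move: zn; rewrite -ball_normE /= => /lt_trans; apply; rewrite ltcR HN.
  by rewrite hnorm_lt ?sqrtr_ge0// sqr_sqrtr// ltW.
apply/cvg_ex; exists (hmk dl).
apply/cvg_ballP => eps eps0.
have epsE : eps = (complex.Re eps)%:C by rewrite RRe_real// gtr0_real.
move: eps0; rewrite {}epsE; move: (complex.Re eps) => e; rewrite ltcR => e0.
have [N HN] := half _ e0.
have [|N' HN'] := ul ((e / 2) ^+ 2); first by rewrite exprn_gt0// divr_gt0.
pose n := maxn N N'.
have h1 := HN n (leq_maxl _ _); have h2 := HN' n (leq_maxr _ _).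
apply: filterS (uP n) => y; rewrite -!ball_normE /= => yn.
have -> : hmk dl - y = (hmk dl - u n) + (u n - y) by rewrite addrA subrK.
rewrite [e]splitr rmorphD; apply: (le_lt_trans (ler_normD _ _)); apply: ltrD.
  by rewrite distrC hnorm_lt// ltW// divr_gt0.
by apply: (lt_trans yn); rewrite ltcR.
Qed.

HB.instance Definition _ :=
  Uniform_isComplete.Build (hilbert_of D) hilbert_of_complete.

Lemma hip_norm x : hip x x = `|x| ^+ 2.
Proof.
rewrite [LHS]dotxx /Num.norm/= /hnorm -rmorphXn sqr_sqrtr//.
exact: redot_ge0.
Qed.

HB.instance Definition _ := isHilbert.Build R (hilbert_of D) hip_norm.

End Complete.

(** * Strong convergence and bounded operators *)

Definition rdot (R : realType) (H : hilbertType R) (x y : H) : R := redot inner x y.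

Notation nsq x := (rdot x x).

Section RealInner.
Variables (R : realType) (H : hilbertType R).
Implicit Types (x y z : H) (r : R).

Lemma rdotDl x y z : rdot (x + y) z = rdot x z + rdot y z.
Proof. exact: redotDl. Qed.
Lemma rdotDr x y z : rdot x (y + z) = rdot x y + rdot x z.
Proof. exact: redotDr. Qed.
Lemma rdotNl x z : rdot (- x) z = - rdot x z.
Proof. exact: redotNl. Qed.
Lemma rdotNr x z : rdot z (- x) = - rdot z x.
Proof. exact: redotNr. Qed.
Lemma rdotZl r x z : rdot (r%:C *: x) z = r * rdot x z.
Proof. exact: redotZl. Qed.
Lemma rdotZr r x z : rdot x (r%:C *: z) = r * rdot x z.
Proof. exact: redotZr. Qed.
Lemma rdot0l x : rdot 0 x = 0.
Proof. exact: redot0l. Qed.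
Lemma rdot0r x : rdot x 0 = 0.
Proof. exact: redot0r. Qed.

Definition rdotE := (rdotDl, rdotDr, rdotNl, rdotNr, rdotZl, rdotZr, rdot0l, rdot0r).

Lemma rdotC x y : rdot x y = rdot y x.
Proof. exact: redotC. Qed.
Lemma nsq_ge0 x : 0 <= nsq x.
Proof. exact: redot_ge0. Qed.
Lemma nsq_eq0 x : nsq x = 0 -> x = 0.
Proof. exact: redot_eq0. Qed.
Lemma rdot_CS x y : rdot x y ^+ 2 <= nsq x * nsq y.
Proof. exact: redot_CS. Qed.
Lemma nsqZ (a : R[i]) x : nsq (a *: x) = complex.Re `|a| ^+ 2 * nsq x.
Proof. exact: redotxxZ. Qed.
Lemma innerE x y : '[x, y] = rdot x y +i* rdot x ('i *: y).
Proof. exact: dot_redot. Qed.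
Lemma innerxx x : '[x, x] = (nsq x)%:C.
Proof. exact: dotxx. Qed.
Lemma rdotZC (a : R[i]) x y : rdot x (a *: y) = rdot (Num.conj a *: x) y.
Proof. by rewrite /rdot /redot linearZr_LR linearZl_LR. Qed.
Lemma innerEl x y : '[x, y] = rdot x y +i* - rdot ('i *: x) y.
Proof.
rewrite innerE rdotZC; congr (_ +i* _); rewrite -rdotNl -scaleNr.
by congr rdot; congr (_ *: _); apply/eqP; rewrite eq_complex /= oppr0 !eqxx.
Qed.

End RealInner.

Lemma cvg0_sqr (R : realType) (g c : R^nat) :
  (forall n, g n ^+ 2 <= c n) -> c @ \oo --> 0 -> g @ \oo --> 0.
Proof.
move=> gc /cvgrPdist_lt c0; apply/cvgrPdist_lt => e e0.
have [N _ HN] := c0 _ (exprn_gt0 2 e0); exists N => // n /HN /=.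
rewrite !sub0r !normrN => cn.
rewrite -(ltr_pXn2r (n := 2)) ?nnegrE ?(ltW e0)// real_normK ?num_real//.
by rewrite (le_lt_trans (gc n))// (le_lt_trans (ler_norm _)).
Qed.

Section HilbertBasics.
Variable R : realType.
Implicit Types H K : hilbertType R.

Lemma norm_nsq H (x : H) : complex.Re `|x| ^+ 2 = nsq x.
Proof. by rewrite /rdot /redot inner_norm normRe -rmorphXn. Qed.

Lemma norm_ltE H (x : H) (e : R) : 0 <= e -> (`|x| < e%:C) = (nsq x < e ^+ 2).
Proof.
by move=> e0; rewrite normRe ltcR -norm_nsq ltr_pXn2r// nnegrE Re_norm_ge0.
Qed.

Lemma norm_leE H (x : H) (e : R) : 0 <= e -> (`|x| <= e%:C) = (nsq x <= e ^+ 2).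
Proof.
by move=> e0; rewrite normRe lecR -norm_nsq ler_pXn2r// nnegrE Re_norm_ge0.
Qed.

Lemma nsqB H (x y : H) : nsq (x - y) = nsq (y - x).
Proof. by rewrite !rdotE; ring. Qed.

Lemma nsqD_le H (x y : H) : nsq (x + y) <= 2 * nsq x + 2 * nsq y.
Proof.
have := nsq_ge0 (x - y); rewrite !rdotE (rdotC y x); lra.
Qed.

Lemma rdot_ext H (x y : H) : (forall z, rdot z x = rdot z y) -> x = y.
Proof.
by move=> h; apply: subr0_eq; apply: nsq_eq0; rewrite rdotDr rdotNr h subrr.
Qed.

(** Convergence in norm, expressed by real numbers: the limit theorems on R then
    apply without a detour through the topology of R[i]. *)
Definition tendsto H (u : nat -> H) (l : H) : Prop :=
  (fun n => nsq (u n - l)) @ \oo --> (0 : R).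

Lemma tendsto_ltP H (u : nat -> H) l : tendsto u l <->
  forall e, 0 < e -> exists N, forall n, (N <= n)%N -> nsq (u n - l) < e.
Proof.
split=> [/cvgrPdist_lt h e /h[N _ HN]|h].
  by exists N => n /HN /=; rewrite sub0r normrN ger0_norm// nsq_ge0.
apply/cvgrPdist_lt => e /h[N HN]; exists N => // n /HN /=.
by rewrite sub0r normrN ger0_norm// nsq_ge0.
Qed.

Lemma tendstoP H (u : nat -> H) l : u @ \oo --> l <-> tendsto u l.
Proof.
rewrite tendsto_ltP; split=> [/cvgrPdist_lt h e e0|h].
  have [|N _ HN] := h (Num.sqrt e)%:C; first by rewrite ltcR sqrtr_gt0.
  exists N => n /HN /=; rewrite distrC norm_ltE ?sqrtr_ge0//.
  by rewrite sqr_sqrtr// ltW.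
apply/cvgrPdist_lt => e e0.
have eE : e = (complex.Re e)%:C by rewrite RRe_real// gtr0_real.
move: e0; rewrite {}eE; move: (complex.Re e) => r; rewrite ltcR => r0.
have [N HN] := h _ (exprn_gt0 2 r0); exists N => // n /HN /=.
by rewrite distrC norm_ltE// ltW.
Qed.

Lemma tendsto_cst H (x : H) : tendsto (fun=> x) x.
Proof. by rewrite /tendsto subrr rdot0l; exact: cvg_cst. Qed.

Lemma hilbert_complete H (u : nat -> H) :
  (forall e : R, 0 < e -> exists N, forall m n, (N <= m)%N -> (N <= n)%N ->
    nsq (u m - u n) < e) -> exists l, tendsto u l.
Proof.
move=> uc; suff /cauchy_cvg /cvg_ex[l ul] : cauchy (u @ \oo).
  by exists l; apply/tendstoP.
apply/cauchy_exP => e e0.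
have eE : e = (complex.Re e)%:C by rewrite RRe_real// gtr0_real.
move: e0; rewrite {}eE; move: (complex.Re e) => r; rewrite ltcR => r0.
have [N HN] := uc _ (exprn_gt0 2 r0); exists (u N).
by exists N => // n Nn; rewrite -ball_normE /= norm_ltE ?(ltW r0)// HN.
Qed.

Lemma hilbert_complete_le H (u : nat -> H) (c : R^nat) :
  (forall m n, (n <= m)%N -> nsq (u m - u n) <= c n) -> c @ \oo --> 0 ->
  exists l, tendsto u l.
Proof.
move=> uc /cvgrPdist_lt c0; apply: hilbert_complete => e e0.
have [N _ HN] := c0 _ e0; exists N => m n Nm Nn.
have lt k : (N <= k)%N -> c k < e.
  by move=> /HN /=; rewrite sub0r normrN; apply: le_lt_trans; exact: ler_norm.
case/orP: (leq_total n m) => nm; first exact: le_lt_trans (uc _ _ nm) (lt _ _).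
by rewrite nsqB; exact: le_lt_trans (uc _ _ nm) (lt _ _).
Qed.

Lemma tendsto_le H K (u : nat -> H) x (v : nat -> K) y c :
  (forall n, nsq (v n - y) <= c * nsq (u n - x)) -> tendsto u x -> tendsto v y.
Proof.
move=> h ux; apply: (@squeeze_cvgr _ _ _ _ (fun=> 0) (fun n => c * nsq (u n - x))).
- by near=> n; rewrite nsq_ge0 h.
- exact: cvg_cst.
- by rewrite -[0 in X in _ --> X](mulr0 c); apply: cvgM; [exact: cvg_cst|].
Unshelve. all: by end_near. Qed.

Lemma tendstoD H (u v : nat -> H) x y :
  tendsto u x -> tendsto v y -> tendsto (fun n => u n + v n) (x + y).
Proof.
move=> ux vy.
apply: (@squeeze_cvgr _ _ _ _ (fun=> 0)
  (fun n => 2 * nsq (u n - x) + 2 * nsq (v n - y))).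
- near=> n; rewrite nsq_ge0 /= (_ : u n + v n - (x + y) = (u n - x) + (v n - y)).
    exact: nsqD_le.
  by rewrite opprD addrACA.
- exact: cvg_cst.
- rewrite -[0 in X in _ --> X](addr0 0) -{1 2}(mulr0 2).
  by apply: cvgD; apply: cvgM => //; exact: cvg_cst.
Unshelve. all: by end_near. Qed.

Lemma tendstoZ H (a : R[i]) (u : nat -> H) x :
  tendsto u x -> tendsto (fun n => a *: u n) (a *: x).
Proof. by apply: tendsto_le => n; rewrite -scalerBr nsqZ. Qed.

Lemma tendstoN H (u : nat -> H) x : tendsto u x -> tendsto (fun n => - u n) (- x).
Proof.
by apply: (@tendsto_le _ _ _ _ _ _ 1) => n; rewrite -opprD !rdotNl rdotNr opprK mul1r.
Qed.

Lemma rdot_cvgl H (u : nat -> H) x y :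
  tendsto u x -> (fun n => rdot (u n) y) @ \oo --> rdot x y.
Proof.
move=> ux; apply: cvg_zero; apply: (@cvg0_sqr _ _ (fun n => nsq (u n - x) * nsq y)).
  move=> n; rewrite -[X in X ^+ 2]/(rdot (u n) y - rdot x y).
  by rewrite -rdotNl -rdotDl rdot_CS.
by rewrite -[0 in X in _ --> X](mul0r (nsq y)); apply: cvgM; [|exact: cvg_cst].
Qed.

Lemma nsq_cvg H (u : nat -> H) x :
  tendsto u x -> (fun n => nsq (u n)) @ \oo --> nsq x.
Proof.
move=> ux; pose v n := nsq (u n - x) + (2 * rdot (u n) x - nsq x).
have -> : (fun n => nsq (u n)) = v.
  by apply/funext => n; rewrite /v !rdotE (rdotC x (u n)); ring.
rewrite [X in _ --> X](_ : _ = 0 + (2 * nsq x - nsq x)); last by ring.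
apply: cvgD => //; apply: cvgB; last exact: cvg_cst.
by apply: cvgM; [exact: cvg_cst|exact: rdot_cvgl].
Qed.

Lemma tendsto_unique H (u : nat -> H) x y : tendsto u x -> tendsto u y -> x = y.
Proof.
move=> ux uy; apply: rdot_ext => z; rewrite !(rdotC z).
exact: (cvg_unique (@Rhausdorff R) (rdot_cvgl ux) (rdot_cvgl uy)).
Qed.

Lemma tendsto_rdot0 H (u : nat -> H) x y :
  (forall n, rdot (u n) y = 0) -> tendsto u x -> rdot x y = 0.
Proof.
move=> uy0 ux; have h := @rdot_cvgl _ _ _ y ux; have {}uy0 : (fun n => rdot (u n) y) = fun=> 0.
  by apply/funext.
by move: h; rewrite uy0 => h; exact: (cvg_unique (@Rhausdorff R) h (cvg_cst 0)).
Qed.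

Lemma closed_tendsto H (F : set H) : closed F <->
  forall u x, (forall n, F (u n)) -> tendsto u x -> F x.
Proof.
split=> [cF u x Fu /tendstoP ux|h x Fx].
  by apply: (closed_cvg F cF _ x ux); near=> n; exact: Fu.
have /choice[u uP] : forall n, exists y, F y /\ nsq (y - x) < n.+1%:R^-1.
  move=> n; pose e : R := Num.sqrt n.+1%:R^-1.
  have e0 : 0 < e by rewrite sqrtr_gt0 invr_gt0.
  have [|y [Fy xy]] := Fx (ball x e%:C).
    by apply: nbhsx_ballx; rewrite ltcR.
  exists y; split => //; move: xy; rewrite -ball_normE /= distrC norm_ltE ?ltW//.
  by rewrite sqr_sqrtr.
apply: (h u); first by move=> n; have [] := uP n.
apply/tendsto_ltP => e e0; have [N HN] := natSinv_lt e0.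
by exists N => n /HN; apply: lt_trans; have [] := uP n.
Unshelve. all: by end_near. Qed.

Lemma bop_bounded H K (f : 'B(H, K)) :
  exists2 c : R, 0 <= c & forall x, nsq (f x) <= c * nsq x.
Proof.
have /linear_bounded_continuous/linear_boundedP [M [Mr hM]] := @bop_continuous _ _ _ f.
have [r r0 Mr1] : exists2 r : R, 0 <= r & M < r%:C.
  exists (`|complex.Re M| + 1); first by rewrite addr_ge0.
  rewrite -(RRe_real Mr) ltcR (le_lt_trans (ler_norm _))// ltrDl//.
exists (r ^+ 2) => [|x]; first exact: sqr_ge0.
have := hM _ Mr1 x; rewrite (normRe (f x)) (normRe x) -rmorphM lecR => h.
by rewrite -!norm_nsq -exprMn ler_pXn2r// nnegrE ?mulr_ge0 ?Re_norm_ge0.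
Qed.

Section MkOp.
Variables (H K : hilbertType R) (f : H -> K) (c : R).
Hypotheses (lf : linear f) (hf : forall x, nsq (f x) <= c * nsq x).

(** Bounds on the squared norm are the working form of continuity: this is how
    bounded operators are built. *)
Definition lin_of : {linear H -> K} := HB.pack f (GRing.isLinear.Build _ _ _ _ f lf).

Lemma lin_of_continuous : continuous lin_of.
Proof.
apply/linear_bounded_continuous/bounded_funP => r.
exists (Num.sqrt ((`|c| + 1) * complex.Re r ^+ 2))%:C => x xr.
rewrite norm_leE ?sqrtr_ge0// sqr_sqrtr; last first.
  by apply: mulr_ge0; [exact: addr_ge0|exact: sqr_ge0].
apply: (le_trans (hf x)); have r0 : 0 <= r by exact: le_trans xr.
have rE : r = (complex.Re r)%:C by rewrite RRe_real// ger0_real.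
move: rE xr r0; move: (complex.Re r) => s ->; rewrite ler0c => + s0.
rewrite norm_leE// => xs.
apply: (le_trans (ler_wpM2r (nsq_ge0 x) (ler_norm c))).
by apply: ler_pM => //; rewrite ?nsq_ge0 ?lerDl.
Qed.

Definition bop_of : 'B(H, K) := BoundedOp lin_of_continuous.

End MkOp.

Lemma tendsto_bop H K (f : 'B(H, K)) (u : nat -> H) x :
  tendsto u x -> tendsto (fun n => f (u n)) (f x).
Proof.
by have [c _ hc] := bop_bounded f; apply: tendsto_le => n; rewrite -linearB.
Qed.

End HilbertBasics.

(** * Riesz representation, adjoints and majorization *)

Lemma le_of_sq (R : realDomainType) (a b : R) :
  0 <= a -> 0 <= b -> a ^+ 2 <= b * a -> a <= b.
Proof.
move=> a0 b0; have [->//|an] := eqVneq a 0.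
by rewrite expr2 ler_pM2r// lt_def an.
Qed.

Lemma quad_eq0 (R : realFieldType) (d q : R) : 0 <= q ->
  (forall t, 0 <= 2 * t * d + t ^+ 2 * q) -> d = 0.
Proof.
move=> q0 /(_ (- d / (q + 1))) h; apply/eqP; rewrite -sqrf_eq0 eq_le sqr_ge0 andbT.
have q1 : 0 < q + 1 by rewrite ltr_wpDl.
have : 0 <= (2 * (- d / (q + 1)) * d + (- d / (q + 1)) ^+ 2 * q) * (q + 1) ^+ 2.
  by rewrite mulr_ge0// sqr_ge0.
rewrite (_ : (_ + _) * _ ^+ 2 = - (d ^+ 2 * (q + 2))); last by field; rewrite gt_eqF.
by rewrite oppr_ge0 pmulr_lle0// ltr_wpDl.
Qed.

Section Operators.
Variable R : realType.
Implicit Types H K : hilbertType R.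

Lemma inner_ext H (x y : H) : (forall z, '[z, x] = '[z, y]) -> x = y.
Proof. by move=> h; apply: rdot_ext => z; exact: (congr1 (@complex.Re R) (h z)). Qed.

(** A functional dominated by |B x| is represented in the closure of the range of B:
    a minimizing sequence of |B x|^2 - 2 f x is Cauchy by the parallelogram
    identity, and the first variation vanishes at its limit. The Riesz theorem is
    the case of the identity, and orthogonal projections and factorizations of
    operators follow from other choices of B and f. *)
Lemma riesz_range (E : lmodType R[i]) K (B : {linear E -> K}) (f : E -> R) (c : R) :
  {morph f : x y / x + y} -> (forall (r : R) x, f (r%:C *: x) = r * f x) ->
  0 <= c -> (forall x, f x ^+ 2 <= c * nsq (B x)) ->
  exists2 z : K, (forall x, rdot (B x) z = f x) &
    exists u : nat -> E, tendsto (fun n => B (u n)) z.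
Proof.
move=> fD fZ c0 fb; pose phi x := nsq (B x) - 2 * f x.
have phi_ge x : - c <= phi x.
  rewrite /phi leNgt; apply/negP => lt.
  have {}lt : nsq (B x) + c < 2 * f x by lra.
  have := fb x; have qB := nsq_ge0 (B x).
  have : (nsq (B x) + c) ^+ 2 < (2 * f x) ^+ 2.
    by rewrite ltr_pXn2r// nnegrE; lra.
  by have := sqr_ge0 (nsq (B x) - c); nra.
have hi : has_inf (range phi).
  by split; [exists (phi 0), 0|exists (- c) => _ [x _ <-]].
pose m := inf (range phi).
have m_le x : m <= phi x by apply: ge_inf; [exact: hi.2|exists x].
have /choice[u uP] : forall n, exists x, phi x < m + n.+1%:R^-1.
  move=> n; have n0 : 0 < n.+1%:R^-1 :> R by rewrite invr_gt0.
  by have [_ [x _ <-] h] := inf_adherent n0 hi; exists x.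
have [||z uz] := @hilbert_complete_le _ _ (fun n => B (u n)) (fun n => 4 * n.+1%:R^-1).
- move=> i j ji.
  have := m_le ((2^-1)%:C *: (u i + u j)).
  rewrite /phi fZ fD linearZ linearD /= !rdotE (rdotC (B (u j)) (B (u i))).
  have := uP i; have := uP j; rewrite /phi.
  have : i.+1%:R^-1 <= j.+1%:R^-1 :> R by rewrite lef_pV2 ?posrE ?ltr0Sn// ler_nat.
  by move: (i.+1%:R^-1) (j.+1%:R^-1) => a b; lra.
- rewrite -[0 in X in _ --> X](mulr0 4).
  by apply: cvgM; [exact: cvg_cst|exact: cvg_harmonic].
exists z; last by exists u.
(* first variation of the functional in the direction x *)
move=> x; apply/eqP; rewrite -subr_eq0; apply/eqP.
apply: (quad_eq0 (nsq_ge0 (B x))) => t.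
pose a n := n.+1%:R^-1 + 2 * t * (rdot (B (u n)) (B x) - f x) + t ^+ 2 * nsq (B x).
have a_ge n : 0 <= a n.
  have := m_le (u n + t%:C *: x); have := uP n; rewrite /phi.
  have -> : B (u n + t%:C *: x) = B (u n) + t%:C *: B x by rewrite linearD linearZ.
  rewrite /a fD fZ !rdotE (rdotC (B x) (B (u n))).
  by move: (n.+1%:R^-1) => b; lra.
have al : a @ \oo --> 0 + 2 * t * (rdot z (B x) - f x) + t ^+ 2 * nsq (B x).
  apply: cvgD; last exact: cvg_cst.
  apply: cvgD; first exact: cvg_harmonic.
  apply: cvgM; first exact: cvg_cst.
  by apply: cvgB; [exact: rdot_cvgl|exact: cvg_cst].
rewrite (rdotC (B x)) -[X in X + _]add0r.
by apply: (ler_cvg_to (cvg_cst 0) al); near=> n; exact: a_ge.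
Unshelve. all: by end_near. Qed.

(** The Riesz theorem for the real functional Re <T x, y>; the imaginary parts agree
    as well because T commutes with multiplication by i. *)
Lemma adjointP H K (T : 'B(H, K)) x y : '[T x, y] = '[x, adjoint T y].
Proof.
have [c c0 Tc] := bop_bounded T.
have [a b|r a||a|z Tz _] := @riesz_range H H
  (GRing.Linear.clone _ _ _ _ idfun _) (fun x => rdot (T x) y) (c * nsq y).
- by rewrite linearD rdotDl.
- by rewrite linearZ /= rdotZl.
- by rewrite mulr_ge0// nsq_ge0.
- apply: (le_trans (rdot_CS _ _)).
  by rewrite mulrAC ler_wpM2r ?nsq_ge0.
suff: [set z | forall x, '[T x, y] = '[x, z]] (adjoint T y) by exact.
apply: (@getI _ _ z) => a /=.
by rewrite !innerEl -linearZ -!Tz.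
Qed.

Lemma rdot_adj H K (T : 'B(H, K)) x y : rdot x (adjoint T y) = rdot (T x) y.
Proof. exact: (congr1 (@complex.Re R) (esym (adjointP T x y))). Qed.

Lemma rdot_adjl H K (T : 'B(H, K)) x y : rdot (adjoint T y) x = rdot y (T x).
Proof. by rewrite rdotC rdot_adj rdotC. Qed.

Lemma adjoint_linear H K (T : 'B(H, K)) : linear (adjoint T).
Proof.
move=> a x y; apply: inner_ext => z.
by rewrite -adjointP !linearPr /= -!adjointP.
Qed.

Lemma adjoint_bounded H K (T : 'B(H, K)) c : 0 <= c ->
  (forall x, nsq (T x) <= c * nsq x) ->
  forall y, nsq (adjoint T y) <= c * nsq y.
Proof.
move=> c0 Tc y; apply: le_of_sq; rewrite ?mulr_ge0 ?nsq_ge0//.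
rewrite [X in X ^+ 2]rdot_adj; apply: (le_trans (rdot_CS _ _)).
by rewrite mulrAC ler_wpM2r ?nsq_ge0.
Qed.

Lemma adjoint_bounded_ex H K (T : 'B(H, K)) :
  exists c, forall y, nsq (adjoint T y) <= c * nsq y.
Proof. by have [c c0 /(adjoint_bounded c0)] := bop_bounded T; exists c. Qed.

Definition badj H K (T : 'B(H, K)) : 'B(K, H) :=
  bop_of (adjoint_linear T) (projT2 (cid (adjoint_bounded_ex T))).

Lemma bcomp_bounded H1 H2 H3 (S : 'B(H2, H3)) (T : 'B(H1, H2)) :
  exists c, forall x, nsq (S (T x)) <= c * nsq x.
Proof.
have [[c c0 hc] [d d0 hd]] := (bop_bounded S, bop_bounded T).
by exists (c * d) => x; rewrite (le_trans (hc _))// -mulrA ler_wpM2l.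
Qed.

Lemma bcomp_linear H1 H2 H3 (S : 'B(H2, H3)) (T : 'B(H1, H2)) :
  linear (fun x => S (T x)).
Proof. by move=> a x y; rewrite !linearP. Qed.

Definition bcomp H1 H2 H3 (S : 'B(H2, H3)) (T : 'B(H1, H2)) : 'B(H1, H3) :=
  bop_of (bcomp_linear S T) (projT2 (cid (bcomp_bounded S T))).

Lemma badd_bounded H K (S T : 'B(H, K)) :
  exists c, forall x, nsq (S x + T x) <= c * nsq x.
Proof.
have [[c c0 hc] [d d0 hd]] := (bop_bounded S, bop_bounded T).
exists (2 * c + 2 * d) => x; rewrite (le_trans (nsqD_le _ _))//.
by have := hc x; have := hd x; lra.
Qed.

Lemma badd_linear H K (S T : 'B(H, K)) : linear (fun x => S x + T x).
Proof. by move=> a x y; rewrite !linearP scalerDr addrACA. Qed.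

Definition badd H K (S T : 'B(H, K)) : 'B(H, K) :=
  bop_of (badd_linear S T) (projT2 (cid (badd_bounded S T))).

Lemma bscale_bounded H (a : R[i]) :
  forall x : H, nsq (a *: x) <= complex.Re `|a| ^+ 2 * nsq x.
Proof. by move=> x; rewrite nsqZ. Qed.

Lemma bscale_linear H (a : R[i]) : linear (fun x : H => a *: x).
Proof. by move=> b x y; rewrite scalerDr !scalerA mulrC. Qed.

Definition bscale H (r : R) : 'B(H) :=
  bop_of (@bscale_linear H r%:C) (@bscale_bounded H r%:C).

Lemma badjE H K (T : 'B(H, K)) x : badj T x = adjoint T x. Proof. by []. Qed.
Lemma bcompE H1 H2 H3 (S : 'B(H2, H3)) (T : 'B(H1, H2)) x :
  bcomp S T x = S (T x).
Proof. by []. Qed.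
Lemma baddE H K (S T : 'B(H, K)) x : badd S T x = S x + T x. Proof. by []. Qed.
Lemma bscaleE H r (x : H) : bscale H r x = r%:C *: x. Proof. by []. Qed.
Definition bopE := (badjE, bcompE, baddE, bscaleE).

(** The projection onto the closure of the range of B, as the representative of the
    functional h |-> Re <B h, k>. *)
Lemma orth_decomp H K (B : 'B(H, K)) (k : K) : exists p q : K,
  [/\ k = p + q, exists u, tendsto (fun n => B (u n)) p
    & forall h, rdot (B h) q = 0].
Proof.
have [||||p Bp up] := @riesz_range H K B (fun h => rdot (B h) k) (nsq k).
- by move=> a b; rewrite linearD rdotDl.
- by move=> r a; rewrite linearZ /= rdotZl.
- exact: nsq_ge0.
- by move=> h; rewrite mulrC rdot_CS.
by exists p, (k - p); split; rewrite ?subrKC// => h; rewrite rdotDr rdotNr Bp subrr.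
Qed.

(** Douglas' factorization. The adjoint g of G is what can be constructed: g y
    represents h |-> Re <A h, y> in the closure of the range of B, and it is unique
    there, hence linear in y. *)
Lemma douglas H K1 K2 (A : 'B(H, K1)) (B : 'B(H, K2)) :
  (forall h, nsq (A h) <= nsq (B h)) ->
  exists G : 'B(K2, K1), [/\ forall h, G (B h) = A h,
    forall k, nsq (G k) <= nsq k
    & forall k, (forall h, rdot (B h) k = 0) -> G k = 0].
Proof.
move=> AB.
have /choice[g gP] : forall y, exists z, (forall h, rdot (B h) z = rdot (A h) y) /\
    exists u, tendsto (fun n => B (u n)) z.
  move=> y; have [||||z Bz uz] :=
    @riesz_range H K2 B (fun h => rdot (A h) y) (nsq y).
  - by move=> a b; rewrite linearD rdotDl.
  - by move=> r a; rewrite linearZ /= rdotZl.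
  - exact: nsq_ge0.
  - by move=> h; apply: (le_trans (rdot_CS _ _)); rewrite mulrC ler_wpM2l ?nsq_ge0.
  by exists z.
have gb y : nsq (g y) <= 1 * nsq y.
  rewrite mul1r; have [By [u uy]] := gP y.
  apply: le_of_sq; rewrite ?nsq_ge0//.
  have c1 : (fun n => rdot (B (u n)) (g y) ^+ 2) @ \oo --> nsq (g y) ^+ 2.
    by apply: cvgM; exact: rdot_cvgl.
  have c2 : (fun n => nsq y * nsq (B (u n))) @ \oo --> nsq y * nsq (g y).
    by apply: cvgM; [exact: cvg_cst|exact: nsq_cvg].
  apply: (ler_cvg_to c1 c2); near=> n.
  rewrite By; apply: (le_trans (rdot_CS _ _)).
  by rewrite mulrC ler_wpM2l ?nsq_ge0.
have glin : linear g.
  move=> a x y; apply/eqP; rewrite -subr_eq0; apply/eqP/nsq_eq0.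
  set w := (X in rdot X X).
  have Bw h : rdot (B h) w = 0.
    rewrite /w !rdotE (gP _).1 rdotZC -linearZ (gP x).1 (gP y).1.
    by rewrite linearZ -rdotZC rdotDr; ring.
  have [v vw] : exists v, tendsto (fun n => B (v n)) w.
    have [[_ [u1 h1]] [[_ [u2 h2]] [_ [u3 h3]]]] := (gP (a *: x + y), (gP x, gP y)).
    exists (fun n => u1 n - (a *: u2 n + u3 n)).
    have -> : (fun n => B (u1 n - (a *: u2 n + u3 n))) =
              (fun n => B (u1 n) + - (a *: B (u2 n) + B (u3 n))).
      by apply/funext => n; rewrite linearB linearP.
    by apply: tendstoD => //; apply: tendstoN; apply: tendstoD => //; exact: tendstoZ.
  by apply: (tendsto_rdot0 _ vw) => n; exact: Bw.
pose G := badj (bop_of glin gb).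
have GE k y : rdot (G k) y = rdot k (g y) by rewrite badjE rdot_adjl.
exists G; split=> [h|k|k Bk].
- by apply: rdot_ext => y; rewrite rdotC GE (gP y).1 rdotC.
- by rewrite badjE -[leRHS]mul1r; apply: adjoint_bounded.
- apply: rdot_ext => y; rewrite rdotC GE rdot0r.
  have [_ [u uy]] := gP y; rewrite rdotC.
  by apply: (tendsto_rdot0 _ uy) => n; exact: Bk.
Unshelve. all: by end_near. Qed.

End Operators.

Section Positive.
Variable R : realType.
Implicit Types H K : hilbertType R.

(** * Positive operators and square roots *)

(** Real parts suffice: for a complex linear A this is self-adjointness. *)
Definition selfadj H (A : H -> H) : Prop := forall x y, rdot (A x) y = rdot x (A y).

Definition psd H (A : H -> H) : Prop := forall x, 0 <= rdot (A x) x.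

Lemma selfadj_badj H K (T : 'B(H, K)) : selfadj (bcomp (badj T) T).
Proof. by move=> x y; rewrite !bopE rdot_adjl rdot_adj. Qed.

Lemma selfadj_badd H (A B : 'B(H)) : selfadj A -> selfadj B -> selfadj (badd A B).
Proof. by move=> sA sB x y; rewrite !bopE rdotDl rdotDr sA sB. Qed.

Lemma selfadj_bscale H r : selfadj (bscale H r).
Proof. by move=> x y; rewrite !bopE rdotZl rdotZr. Qed.

Lemma selfadj_bscaleM H r (A : 'B(H)) :
  selfadj A -> selfadj (bcomp (bscale H r) A).
Proof. by move=> sA x y; rewrite !bopE rdotZl rdotZr sA. Qed.

Lemma selfadj_conj H K (A : 'B(K)) (T : 'B(H, K)) :
  selfadj A -> selfadj (bcomp (badj T) (bcomp A T)).
Proof. by move=> sA x y; rewrite !bopE rdot_adjl rdot_adj sA. Qed.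

Lemma selfadj_polar H (A : 'B(H)) x y : selfadj A ->
  2 * rdot (A x) y = rdot (A (x + y)) (x + y) - rdot (A x) x - rdot (A y) y.
Proof. by move=> sA; rewrite linearD !rdotE (sA y x) (rdotC y (A x)); ring. Qed.

(** Evaluate the positive form of A at c x - A x. *)
Lemma psd_nsq_le H (A : 'B(H)) c : selfadj A -> psd A -> 0 <= c ->
  (forall x, rdot (A x) x <= c * nsq x) ->
  forall x, nsq (A x) <= c * rdot (A x) x.
Proof.
move=> sA pA c0 Ac x.
have key s : 0 <= s ^+ 2 * rdot (A x) x - 2 * s * nsq (A x) + c * nsq (A x).
  apply: le_trans (pA (s%:C *: x - A x)) _.
  have -> : A (s%:C *: x - A x) = s%:C *: A x - A (A x).
    by rewrite linearB linearZ.
  have := Ac (A x); rewrite !rdotE (sA (A x) x); lra.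
have := key c; have := key 1; have := pA x; have := Ac x; have := nsq_ge0 (A x).
move: (rdot (A x) x) (nsq (A x)) (nsq x) => a n q n0 ac a0 k1 kc.
have [c00|c1] := eqVneq c 0; first by move: k1 ac; rewrite c00; lra.
have cp : 0 < c by rewrite lt_def c1.
by rewrite -(ler_pM2l cp); move: kc; lra.
Qed.

Lemma psd_contractive H (A : 'B(H)) : selfadj A -> psd A ->
  (forall x, rdot (A x) x <= nsq x) -> forall x, nsq (A x) <= nsq x.
Proof.
move=> sA pA A1 x; apply: le_trans (A1 x); rewrite -[leRHS]mul1r.
by apply: psd_nsq_le => // y; rewrite mul1r.
Qed.

(** By [psd_nsq_le], |X_m x - X_n x|^2 is at most c times the difference of two terms
    of the bounded monotone sequence <X_n x, x>. *)
Lemma monotone_limit H (X : nat -> 'B(H)) (c : R) :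
  (forall n, selfadj (X n)) -> (forall n, psd (X n)) -> 0 <= c ->
  (forall n x, rdot (X n x) x <= rdot (X n.+1 x) x) ->
  (forall n x, rdot (X n x) x <= c * nsq x) ->
  exists Y : 'B(H), selfadj Y /\ forall x, tendsto (fun n => X n x) (Y x).
Proof.
move=> sX pX c0 Xmon Xc.
have mon x : nondecreasing_seq (fun n => rdot (X n x) x).
  by apply/nondecreasing_seqP => n; exact: Xmon.
have cv x : cvgn (fun n => rdot (X n x) x).
  apply: nondecreasing_is_cvgn; first exact: mon.
  by exists (c * nsq x) => _ [n _ <-].
have /choice[Y YP] : forall x, exists y, tendsto (fun n => X n x) y.
  move=> x; pose l := limn (fun n => rdot (X n x) x).
  apply: (@hilbert_complete_le _ _ _ (fun n => c * (l - rdot (X n x) x))).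
    move=> m n nm; pose D := badd (X m) (bcomp (bscale H (-1)) (X n)).
    have DE z : D z = X m z - X n z.
      by rewrite /D !bopE rmorphN rmorph1 scaleN1r.
    have Dq z : rdot (D z) z = rdot (X m z) z - rdot (X n z) z.
      by rewrite DE !rdotE.
    rewrite -DE; apply: (@le_trans _ _ (c * rdot (D x) x)); last first.
      by rewrite Dq ler_wpM2l// lerD2r; exact: nondecreasing_cvgn_le.
    apply: psd_nsq_le => //.
    - by apply: selfadj_badd => //; exact: selfadj_bscaleM.
    - by move=> z; rewrite Dq subr_ge0; exact: mon.
    - by move=> z; rewrite Dq; have := Xc m z; have := pX n z; lra.
  rewrite -[0 in X in _ --> X](mulr0 c) -[in X in _ --> X](subrr l).
  by apply: cvgM; [exact: cvg_cst|apply: cvgB; [exact: cvg_cst|exact: cv]].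
have Ylin : linear Y.
  move=> a x y; apply: (tendsto_unique (YP _)).
  rewrite (_ : (fun n => _) = (fun n => a *: X n x + X n y)).
    by apply: tendstoD => //; exact: tendstoZ.
  by apply/funext => n; rewrite linearP.
have Yb x : nsq (Y x) <= c ^+ 2 * nsq x.
  apply: (ler_cvg_to (nsq_cvg (YP x)) (cvg_cst _)); near=> n.
  apply: (le_trans (psd_nsq_le (sX n) (pX n) c0 (Xc n) x)).
  by rewrite expr2 -mulrA ler_wpM2l.
exists (bop_of Ylin Yb); split => // x y.
apply: (cvg_unique (@Rhausdorff R) (rdot_cvgl (YP x))).
rewrite rdotC (_ : (fun n => _) = (fun n => rdot (X n y) x)); first exact: rdot_cvgl.
by apply/funext => n; rewrite sX rdotC.
Unshelve. all: by end_near. Qed.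

(** The operators p(A) for the polynomials p with nonnegative coefficients. *)
Inductive pcone H (A : H -> H) : (H -> H) -> Prop :=
| pcone_id : pcone A (fun x => x)
| pcone_add P Q : pcone A P -> pcone A Q -> pcone A (fun x => P x + Q x)
| pcone_scale r P : 0 <= r -> pcone A P -> pcone A (fun x => r%:C *: P x)
| pcone_op P : pcone A P -> pcone A (fun x => A (P x)).

Lemma pcone_comp H (A P Q : H -> H) : pcone A P -> pcone A Q ->
  pcone A (fun x => P (Q x)).
Proof.
move=> cP cQ; elim: cP => {P} [//|P P' _ IH _ IH'|r P r0 _ IH|P _ IH].
- exact: pcone_add.
- exact: pcone_scale.
- exact: pcone_op.
Qed.

Lemma iter_psd H (A : 'B(H)) n : selfadj A -> psd A -> psd (iter n A).
Proof.
move=> sA pA; suff key k x : 0 <= rdot (iter k A x) x /\ 0 <= rdot (iter k.+1 A x) x.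
  by move=> x; have [] := key n x.
elim: k x => [|k IH] x; first by split; [exact: nsq_ge0|exact: pA].
split; first by have [] := IH x.
by rewrite iterS iterSr sA; have [] := IH (A x).
Qed.

(** Even powers of A are squares and odd powers are conjugates of A by a power of A,
    so all monomials are positive; the statement proved by induction composes P with
    an arbitrary power of A because composing with A alone does not preserve
    positivity. *)
Lemma pcone_psd H (A : 'B(H)) P : selfadj A -> psd A -> pcone A P -> psd P.
Proof.
move=> sA pA cP; suff key n x : 0 <= rdot (iter n A (P x)) x by exact: (key 0%N).
elim: cP n x => {P} [|P P' _ IH _ IH'|r P r0 _ IH|P _ IH] n x.
- exact: iter_psd.
- suff -> : iter n A (P x + P' x) = iter n A (P x) + iter n A (P' x).
    by rewrite rdotDl addr_ge0.
  by elim: n => //= n ->; rewrite linearD.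
- suff -> : iter n A (r%:C *: P x) = r%:C *: iter n A (P x).
    by rewrite rdotZl mulr_ge0.
  by elim: n => //= n ->; rewrite linearZ.
- by rewrite -iterSr; exact: IH.
Qed.

(** Iteration of Y |-> (A + Y^2) / 2. A fixed point Y satisfies
    (I - Y)^2 = I - A, so that I - Y is a square root of I - A. *)
Fixpoint sqrt_approx H (A : 'B(H)) (n : nat) : 'B(H) :=
  if n is n'.+1 then
    bcomp (bscale H 2^-1) (badd A (bcomp (sqrt_approx A n') (sqrt_approx A n')))
  else bscale H 0.

Lemma sqrt_approxS H (A : 'B(H)) n x : sqrt_approx A n.+1 x =
  (2^-1)%:C *: (A x + sqrt_approx A n (sqrt_approx A n x)).
Proof. by []. Qed.

Section SqrtApprox.
Variables (H : hilbertType R) (A : 'B(H)).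
Hypotheses (sA : selfadj A) (pA : psd A) (A1 : forall x, rdot (A x) x <= nsq x).
Local Notation Y := (sqrt_approx A).

Lemma sqrt_approx_selfadj n : selfadj (Y n).
Proof.
elim: n => [|n IH]; first exact: selfadj_bscale.
apply: selfadj_bscaleM; apply: selfadj_badd => // x y.
by rewrite !bopE !IH.
Qed.

Lemma sqrt_approx_pcone n : pcone A (Y n).
Proof.
elim: n => [|n IH]; first exact: (pcone_scale (lexx 0) (pcone_id A)).
apply: (@pcone_scale _ A 2^-1 (fun x => A x + Y n (Y n x))) => //.
apply: pcone_add; first exact: (pcone_op (pcone_id A)).
exact: (pcone_comp IH IH).
Qed.

Lemma sqrt_approx_psd n : psd (Y n).
Proof. exact: pcone_psd (sqrt_approx_pcone n). Qed.

Lemma sqrt_approx_le1 n x : rdot (Y n x) x <= nsq x.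
Proof.
elim: n x => [|n IH] x; first by rewrite bscaleE rdotZl mul0r nsq_ge0.
rewrite sqrt_approxS rdotZl rdotDl [X in _ + X]sqrt_approx_selfadj.
have := psd_contractive (@sqrt_approx_selfadj n) (@sqrt_approx_psd n) IH x.
by have := A1 x; lra.
Qed.

(** Y_(n+2) - Y_(n+1) is half of Y_(n+1) D + D Y_n with D = Y_(n+1) - Y_n, so the
    increments remain polynomials in A with nonnegative coefficients. This is what
    makes the sequence increasing. *)
Lemma sqrt_approx_incr n :
  exists2 D, pcone A D & forall x, Y n.+1 x = Y n x + D x.
Proof.
elim: n => [|n [D cD IH]].
  exists (fun x => (2^-1)%:C *: A x).
    by apply: pcone_scale => //; exact: (pcone_op (pcone_id A)).
  have Y0 z : Y 0 z = 0 by rewrite [LHS]bscaleE rmorph0 scale0r.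
  by move=> x; rewrite sqrt_approxS !Y0 addr0 add0r.
exists (fun x => (2^-1)%:C *: (D (Y n x) + Y n.+1 (D x))).
  apply: pcone_scale => //; apply: pcone_add; apply: pcone_comp => //;
    exact: sqrt_approx_pcone.
move=> x; rewrite sqrt_approxS [in RHS]sqrt_approxS -scalerDr -addrA.
congr (_ *: (_ + _)).
by rewrite [Y n.+1 x]IH linearD [Y n.+1 (Y n x)]IH addrA.
Qed.

Lemma sqrt_approx_mono n x : rdot (Y n x) x <= rdot (Y n.+1 x) x.
Proof.
have [D cD ->] := sqrt_approx_incr n.
by rewrite rdotDl lerDl; exact: (pcone_psd sA pA cD).
Qed.

Lemma sqrt_limit : exists Y : 'B(H), [/\ selfadj Y,
  forall x, rdot (Y x) x <= nsq x & forall x, Y x + Y x = A x + Y (Y x)].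
Proof.
have [|L [sL YL]] := monotone_limit sqrt_approx_selfadj sqrt_approx_psd
  (ler01 : 0 <= 1 :> R) sqrt_approx_mono.
  by move=> n x; rewrite mul1r; exact: sqrt_approx_le1.
exists L; split=> // x.
  apply: (ler_cvg_to (rdot_cvgl (YL x)) (cvg_cst _)); near=> n.
  exact: sqrt_approx_le1.
have YYL : tendsto (fun n => Y n (Y n x)) (L (L x)).
  rewrite (_ : (fun n => _) = (fun n => Y n (Y n x - L x) + Y n (L x))); last first.
    by apply/funext => n; rewrite -linearD subrK.
  rewrite -[L (L x)]add0r; apply: tendstoD => //.
  apply: (@tendsto_le _ _ _ _ _ _ _ 1) (YL x) => n.
  rewrite subr0 mul1r; apply: psd_contractive.
  - exact: sqrt_approx_selfadj.
  - exact: sqrt_approx_psd.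
  - exact: sqrt_approx_le1.
have Y1 : tendsto (fun n => Y n.+1 x) (L x).
  by have := YL x; rewrite /tendsto -(cvg_shiftS (fun n => nsq (Y n x - L x))).
have : tendsto (fun n => Y n.+1 x + Y n.+1 x) (A x + L (L x)).
  rewrite (_ : (fun n => _) = (fun n => A x + Y n (Y n x))).
    by apply: tendstoD => //; exact: tendsto_cst.
  apply/funext => n; rewrite sqrt_approxS -scalerDl -rmorphD.
  by rewrite (_ : 2^-1 + 2^-1 = 1 :> R) ?rmorph1 ?scale1r//; lra.
by apply: tendsto_unique; exact: tendstoD.
Unshelve. all: by end_near. Qed.

End SqrtApprox.

Lemma sqrt_op1 H (B : 'B(H)) : selfadj B -> psd B ->
  (forall x, rdot (B x) x <= nsq x) ->
  exists Z : 'B(H), [/\ selfadj Z, psd Z & forall x, Z (Z x) = B x].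
Proof.
move=> sB pB B1; pose A := badd (bscale H 1) (bcomp (bscale H (-1)) B).
have AE x : A x = x - B x.
  by rewrite /A !bopE rmorphN rmorph1 scaleN1r scale1r.
have sA : selfadj A.
  by apply: selfadj_badd; [exact: selfadj_bscale|exact: selfadj_bscaleM].
have [||Y [sY Y1 YE]] := sqrt_limit sA.
- by move=> x; rewrite AE !rdotE subr_ge0.
- by move=> x; rewrite AE !rdotE gerBl.
exists (badd (bscale H 1) (bcomp (bscale H (-1)) Y)).
have ZE x : badd (bscale H 1) (bcomp (bscale H (-1)) Y) x = x - Y x.
  by rewrite !bopE rmorphN rmorph1 scaleN1r scale1r.
split=> [|x|x]; first by
  apply: selfadj_badd; [exact: selfadj_bscale|exact: selfadj_bscaleM].
- by rewrite ZE !rdotE subr_ge0.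
- have -> : B x = x - (Y x + Y x - Y (Y x)) by rewrite YE addrK AE subKr.
  by rewrite !ZE linearB !opprD !opprK !addrA.
Qed.

Lemma psd_bound H (B : 'B(H)) :
  exists2 c, 0 < c & forall x, rdot (B x) x <= c * nsq x.
Proof.
have [c c0 Bc] := bop_bounded B; exists (c + 1); first by rewrite ltr_wpDl.
move=> x; have c1 : 0 <= (c + 1) * nsq x by rewrite mulr_ge0 ?nsq_ge0// addr_ge0.
have [h|h] := leP (rdot (B x) x) 0; first exact: le_trans c1.
rewrite -(ler_pXn2r (n := 2)) ?nnegrE// ?(ltW h)//.
apply: (le_trans (rdot_CS _ _)); have := Bc x; have := nsq_ge0 x.
move: (nsq x) (nsq (B x)) => q b q0 bc; nra.
Qed.

Lemma sqrt_op H (B : 'B(H)) : selfadj B -> psd B ->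
  exists Z : 'B(H), [/\ selfadj Z, psd Z & forall x, Z (Z x) = B x].
Proof.
move=> sB pB; have [c c0 Bc] := psd_bound B.
have [|||Z [sZ pZ ZZ]] := @sqrt_op1 _ (bcomp (bscale H c^-1) B).
- exact: selfadj_bscaleM.
- by move=> x; rewrite !bopE rdotZl mulr_ge0// invr_ge0 ltW.
- by move=> x; rewrite !bopE rdotZl ler_pdivrMl.
have s0 : 0 <= Num.sqrt c by exact: sqrtr_ge0.
exists (bcomp (bscale H (Num.sqrt c)) Z); split.
- exact: selfadj_bscaleM.
- by move=> x; rewrite !bopE rdotZl mulr_ge0.
- move=> x; rewrite !bopE linearZ /= ZZ !bopE !scalerA -!rmorphM.
  by rewrite -expr2 sqr_sqrtr ?(ltW c0)// divff ?gt_eqF// scale1r.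
Qed.

(** A quadratic form with real values is Hermitian: polarize its imaginary part at
    x + i y. *)
Lemma ople0_psd H (B : H -> H) : linear B -> ople (fun=> 0) B -> selfadj B /\ psd B.
Proof.
move=> lB pB; have B0 x : rdot (B x) ('i *: x) = 0 /\ 0 <= rdot (B x) x.
  have := pB x; rewrite innerE [X in _ <= X -> _]innerE lecE !rdot0l /=.
  by move=> /andP[/eqP].
split=> [x y|x]; last by have [] := B0 x.
pose L : {linear H -> H} := HB.pack B (GRing.isLinear.Build _ _ _ _ B lB).
have BD u v : B (u + v) = B u + B v by exact: (linearD L).
have BZ a u : B (a *: u) = a *: B u by exact: (linearZ_LR L).
have ii (u : H) : 'i *: ('i *: u) = - u by rewrite scalerA -expr2 sqr_i scaleN1r.
have rii (u v : H) : rdot ('i *: u) ('i *: v) = rdot u v.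
  by rewrite rdotZC scalerA -normCKC normc_def /= expr0n expr1n add0r sqrtr1 expr1n scale1r.
have [+ _] := B0 (x + 'i *: y); have [h1 _] := B0 x; have [h2 _] := B0 ('i *: y).
rewrite scalerDr BD !rdotE h1 h2 ii BZ rii !rdotE (rdotC x); lra.
Qed.

Lemma opnorm_has_sup H K (A : 'B(H, K)) :
  has_sup [set complex.Re `|A x| | x in [set x : H | `|x| <= 1]].
Proof.
split; first by exists (complex.Re `|A 0|), 0; rewrite //= normr0.
have [c c0 Ac] := bop_bounded A.
exists (Num.sqrt c) => _ [x /= x1 <-].
rewrite -lecR -normRe norm_leE ?sqrtr_ge0// sqr_sqrtr//.
apply: (le_trans (Ac x)); rewrite ler_piMr//.
by move: x1; rewrite (_ : 1 = 1%:C)// norm_leE// expr1n.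
Qed.

Lemma opnorm_ge0 H K (A : 'B(H, K)) : 0 <= opnorm A.
Proof.
apply: le_trans (Re_norm_ge0 (A 0)) _; apply: sup_upper_bound.
  exact: opnorm_has_sup.
by exists 0; rewrite //= normr0.
Qed.

Lemma opnorm_bound H K (A : 'B(H, K)) x : nsq (A x) <= opnorm A ^+ 2 * nsq x.
Proof.
have [x0|x0] := eqVneq (nsq x) 0.
  by rewrite (nsq_eq0 x0) linear0 !rdot0l mulr0.
have xp : 0 < nsq x by rewrite lt_def x0 nsq_ge0.
pose s := Num.sqrt (nsq x).
have s2 : s ^+ 2 = nsq x by rewrite sqr_sqrtr ?nsq_ge0.
have sp : 0 < s by rewrite sqrtr_gt0.
have : complex.Re `|A ((s^-1)%:C *: x)| <= opnorm A.
  apply: sup_upper_bound; first exact: opnorm_has_sup.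
  exists ((s^-1)%:C *: x) => //=.
  rewrite (_ : 1 = 1%:C)// norm_leE// !rdotE -s2 expr1n mulrA -expr2.
  by rewrite -exprMn mulVf ?gt_eqF// expr1n.
rewrite -(ler_pXn2r (n := 2)) ?nnegrE ?Re_norm_ge0 ?opnorm_ge0//.
rewrite norm_nsq linearZ /= !rdotE mulrA -expr2 exprVn.
by rewrite ler_pdivrMl ?exprn_gt0// s2 mulrC.
Qed.

Lemma opnorm_le H K (A : 'B(H, K)) c : 0 <= c ->
  (forall x, nsq (A x) <= c ^+ 2 * nsq x) -> opnorm A <= c.
Proof.
move=> c0 Ac; apply: ge_sup; first by case: (opnorm_has_sup A).
move=> _ [x /= x1 <-]; rewrite -lecR -normRe norm_leE//.
apply: (le_trans (Ac x)); rewrite ler_piMr ?sqr_ge0//.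
by move: x1; rewrite (_ : 1 = 1%:C)// norm_leE// expr1n.
Qed.

Lemma opnorm_quad H (A : 'B(H)) x : rdot (A x) x <= opnorm A * nsq x.
Proof.
have [h|h] := leP (rdot (A x) x) 0.
  by apply: le_trans h _; rewrite mulr_ge0 ?opnorm_ge0 ?nsq_ge0.
rewrite -(ler_pXn2r (n := 2)) ?nnegrE ?(ltW h) ?mulr_ge0 ?opnorm_ge0 ?nsq_ge0//.
apply: (le_trans (rdot_CS _ _)).
by rewrite exprMn [in leRHS]expr2 mulrA ler_wpM2r ?nsq_ge0// opnorm_bound.
Qed.

Lemma opnorm_psd_le H (A : 'B(H)) c : selfadj A -> psd A -> 0 <= c ->
  (forall x, rdot (A x) x <= c * nsq x) -> opnorm A <= c.
Proof.
move=> sA pA c0 Ac; apply: opnorm_le => // x.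
by rewrite (le_trans (psd_nsq_le sA pA c0 Ac x))// expr2 -mulrA ler_wpM2l.
Qed.

End Positive.

(** * Closed subspaces, direct sums and square-summable sequences *)

Section Isometric.
Variable R : realType.
Implicit Types H K : hilbertType R.

Lemma isometricP H K (J : 'B(H, K)) : (forall x, nsq (J x) = nsq x) -> isometric J.
Proof.
move=> Jn; have Jr x y : rdot (J x) (J y) = rdot x y.
  have := Jn (x + y); rewrite linearD !rdotE !Jn (rdotC (J y)) (rdotC y); lra.
suff h x y : '[J x, J y] = '[x, y] by exact: h.
by rewrite !innerE -linearZ !Jr.
Qed.

Lemma isometric_rdot H K (J : 'B(H, K)) x y : isometric J -> rdot (J x) (J y) = rdot x y.
Proof. by move=> JJ; exact: (congr1 (@complex.Re R) (JJ x y)). Qed.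

End Isometric.

Section Subspace.
Variables (R : realType) (K : hilbertType R) (F : set K).
Hypothesis cF : closed_subspace F.

Lemma subspace_complete (u : nat -> K) : (forall n, F (u n)) ->
  (forall e : R, 0 < e -> exists N, forall m n, (N <= m)%N -> (N <= n)%N ->
     complex.Re '[u m - u n, u m - u n] < e) ->
  exists2 l, F l & forall e : R, 0 < e -> exists N, forall n, (N <= n)%N ->
     complex.Re '[u n - l, u n - l] < e.
Proof.
move=> Fu /hilbert_complete[l ul]; exists l; last exact/tendsto_ltP.
by case: cF => /closed_tendsto cl _ _; exact: cl ul.
Qed.

Lemma inner_linl (a : R[i]) (x y z : K) : '[a *: x + y, z] = a * '[x, z] + '[y, z].
Proof. by rewrite linearPl. Qed.

Lemma inner_conj (x y : K) : '[x, y] = Num.conj '[y, x].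
Proof. by have := hermC inner x y; rewrite /= expr0 mul1r. Qed.

Lemma inner_pos (x : K) : x != 0 -> 0 < '[x, x].
Proof. exact: neq0_dnorm_gt0. Qed.

Definition subspace_data : hilbert_data R := @HilbertData R K F (fun x y => '[x, y])
  (let: And3 _ F0 _ := cF in F0)
  (let: And3 _ _ FP := cF in FP)
  (fun a x y z _ _ _ => inner_linl a x y z)
  (fun x y _ _ => inner_conj x y)
  (fun x _ => @inner_pos x)
  subspace_complete.

Definition subspace : hilbertType R := hilbert_of subspace_data.

End Subspace.

Section DirectSum.
Variables (R : realType) (H K : hilbertType R).

Let ip (x y : H * K) : R[i] := '[x.1, y.1] + '[x.2, y.2].

Let ipxx x : ip x x = (nsq x.1 + nsq x.2)%:C.
Proof. by rewrite /ip !innerxx rmorphD. Qed.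

Let ip_linl a x y z : ip (a *: x + y) z = a * ip x z + ip y z.
Proof. by rewrite /ip /= !inner_linl; ring. Qed.

Let ip_conj x y : ip x y = Num.conj (ip y x).
Proof. by rewrite /ip rmorphD /= -!inner_conj. Qed.

Let ip_gt0 x : x != 0 -> 0 < ip x x.
Proof.
move=> x0; rewrite ipxx ltcR lt_def addr_ge0 ?nsq_ge0// andbT.
apply: contra_neq x0 => /eqP; rewrite paddr_eq0 ?nsq_ge0// => /andP[/eqP h1 /eqP h2].
by move: (nsq_eq0 h1) (nsq_eq0 h2); case: (x) => a b /= -> ->.
Qed.

Let ip_complete (u : nat -> H * K) : (forall n, setT (u n)) ->
  (forall e : R, 0 < e -> exists N, forall m n, (N <= m)%N -> (N <= n)%N ->
     complex.Re (ip (u m - u n) (u m - u n)) < e) ->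
  exists2 l, setT l & forall e : R, 0 < e -> exists N, forall n, (N <= n)%N ->
     complex.Re (ip (u n - l) (u n - l)) < e.
Proof.
move=> _ uc.
have [|l1 h1] := @hilbert_complete R H (fun n => (u n).1).
  move=> e /uc[N HN]; exists N => m n Nm Nn; apply: le_lt_trans (HN m n Nm Nn).
  by rewrite ipxx /= lerDl nsq_ge0.
have [|l2 h2] := @hilbert_complete R K (fun n => (u n).2).
  move=> e /uc[N HN]; exists N => m n Nm Nn; apply: le_lt_trans (HN m n Nm Nn).
  by rewrite ipxx /= lerDr nsq_ge0.
exists (l1, l2) => // e e0; have e2 : 0 < e / 2 by rewrite divr_gt0.
have [N1 H1] := (tendsto_ltP _ _).1 h1 _ e2.
have [N2 H2] := (tendsto_ltP _ _).1 h2 _ e2.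
exists (maxn N1 N2) => n; rewrite geq_max => /andP[/H1 n1 /H2 n2].
by rewrite ipxx /= [e]splitr ltrD.
Qed.

Definition dsum_data : hilbert_data R := @HilbertData R (H * K)%type setT ip
  I (fun _ _ _ _ _ => I) (fun a x y z _ _ _ => ip_linl a x y z)
  (fun x y _ _ => ip_conj x y) (fun x _ => @ip_gt0 x) ip_complete.

Definition dsum : hilbertType R := hilbert_of dsum_data.

Definition dpair (x : H) (y : K) : dsum := @hmk R dsum_data (x, y) I.

Definition dfst (z : dsum) : H := (@hval R dsum_data z).1.
Definition dsnd (z : dsum) : K := (@hval R dsum_data z).2.

Lemma dpairK z : dpair (dfst z) (dsnd z) = z.
Proof. by apply: val_inj => /=; rewrite /dfst /dsnd; case: (@hval R dsum_data z). Qed.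

Lemma dpairP a x y x' y' :
  dpair (a *: x + x') (a *: y + y') = a *: dpair x y + dpair x' y'.
Proof. exact: val_inj. Qed.

Lemma dfst_linear : linear dfst. Proof. by []. Qed.
Lemma dsnd_linear : linear dsnd. Proof. by []. Qed.

Lemma dsum_rdot z w : rdot z w = rdot (dfst z) (dfst w) + rdot (dsnd z) (dsnd w).
Proof. by rewrite /rdot /redot -cReD. Qed.

End DirectSum.

Section SquareSummable.
Variables (R : realType) (H : hilbertType R).
Implicit Types (f g h : nat -> H).

(** Convergence of the real and imaginary parts is stable under the operations that
    occur in the axioms of an inner product, and avoids complex limits. *)
Definition ccvg (s : nat -> R[i]) (z : R[i]) : Prop :=
  (fun n => complex.Re (s n)) @ \oo --> complex.Re z /\
  (fun n => complex.Im (s n)) @ \oo --> complex.Im z.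

Let ccvg_unique s z w : ccvg s z -> ccvg s w -> z = w.
Proof.
move=> [h1 h2] [h3 h4]; apply/eqP; rewrite eq_complex.
by rewrite (cvg_unique (@Rhausdorff R) h1 h3) (cvg_unique (@Rhausdorff R) h2 h4) !eqxx.
Qed.

Let ccvgD s t z w : ccvg s z -> ccvg t w -> ccvg (fun n => s n + t n) (z + w).
Proof.
move=> [h1 h2] [h3 h4]; split.
  rewrite cReD (_ : (fun n => _) = fun n => complex.Re (s n) + complex.Re (t n)).
    exact: cvgD.
  by apply/funext => n; rewrite cReD.
rewrite cImD (_ : (fun n => _) = fun n => complex.Im (s n) + complex.Im (t n)).
  exact: cvgD.
by apply/funext => n; rewrite cImD.
Qed.

Let ccvgZ a s z : ccvg s z -> ccvg (fun n => a * s n) (a * z).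
Proof.
move=> [h1 h2].
have ccReM (b c : R[i]) : complex.Re (b * c) =
    complex.Re b * complex.Re c - complex.Im b * complex.Im c by exact: cReM.
have cImM (b c : R[i]) : complex.Im (b * c) =
    complex.Re b * complex.Im c + complex.Im b * complex.Re c.
  by case: b c => [? ?] [? ?].
split.
  rewrite ccReM (_ : (fun n => _) = fun n => complex.Re a * complex.Re (s n) -
      complex.Im a * complex.Im (s n)); last by apply/funext => n; rewrite ccReM.
  by apply: cvgB; apply: cvgM => //; exact: cvg_cst.
rewrite cImM (_ : (fun n => _) = fun n => complex.Re a * complex.Im (s n) +
      complex.Im a * complex.Re (s n)); last by apply/funext => n; rewrite cImM.
by apply: cvgD; apply: cvgM => //; exact: cvg_cst.
Qed.

Let ccvg_conj s z : ccvg s z -> ccvg (fun n => Num.conj (s n)) (Num.conj z).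
Proof.
move=> [h1 h2]; have ReC (a : R[i]) : complex.Re (Num.conj a) = complex.Re a by case: a.
have ImC (a : R[i]) : complex.Im (Num.conj a) = - complex.Im a by case: a.
split.
  by rewrite ReC (_ : (fun n => _) = fun n => complex.Re (s n))//; apply/funext.
rewrite ImC (_ : (fun n => _) = fun n => - complex.Im (s n)); first exact: cvgN.
exact/funext.
Qed.

Let psum f g n : R[i] := \sum_(i < n) '[f i, g i].
Let qsum f n : R := \sum_(i < n) nsq (f i).

Let psumxx f n : psum f f n = (qsum f n)%:C.
Proof.
by rewrite /psum /qsum rmorph_sum; apply: eq_bigr => i _; rewrite innerxx.
Qed.

Let qsum_nd f : nondecreasing_seq (qsum f).
Proof.
by apply/nondecreasing_seqP => n; rewrite /qsum big_ord_recr lerDl nsq_ge0.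
Qed.

Definition square_summable f : Prop := exists M, forall n, \sum_(i < n) nsq (f i) <= M.

Let dom := square_summable.

Let qsum_cvg f : dom f -> cvgn (qsum f).
Proof.
move=> [M fM]; apply: nondecreasing_is_cvgn; first exact: qsum_nd.
by exists M => _ [n _ <-]; exact: fM.
Qed.

Let domP (a : R[i]) f g : dom f -> dom g -> dom (a *: f + g).
Proof.
move=> [M fM] [N gN]; pose c := complex.Re `|a| ^+ 2.
exists (2 * (c * M) + 2 * N) => n.
apply: (@le_trans _ _ (\sum_(i < n) (2 * (c * nsq (f i)) + 2 * nsq (g i)))).
  by apply: ler_sum => i _; rewrite (le_trans (nsqD_le _ _))// nsqZ.
rewrite big_split /= -!mulr_sumr; apply: lerD; rewrite ler_pM2l//; last exact: gN.
by rewrite ler_wpM2l ?sqr_ge0 ?fM.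
Qed.

Let dom0 : dom 0.
Proof. by exists 0 => n; rewrite big1// => i _; rewrite rdot0l. Qed.

(** By polarization the partial sums are combinations of partial sums of squared
    norms, which are monotone and bounded. *)
Let Re_psum_cvg f g : dom f -> dom g -> cvgn (fun n => complex.Re (psum f g n)).
Proof.
move=> df dg; have dfg := domP 1 df dg.
apply/cvg_ex; eexists.
rewrite (_ : (fun n => _) =
  fun n => 2^-1 * (qsum (1 *: f + g) n - (qsum f n + qsum g n))).
  apply: cvgM; first exact: cvg_cst.
  by apply: cvgB; [exact: qsum_cvg|apply: cvgD; exact: qsum_cvg].
apply/funext => n; rewrite /qsum -big_split /= -sumrB mulr_sumr /psum.
elim/big_ind2 : _ => // [z1 x1 z2 x2 <- <-|i _]; first by rewrite cReD.
rewrite -[complex.Re _]/(rdot (f i) (g i)) -[(1 *: f + g) i]/(1 *: f i + g i) scale1r.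
by rewrite !rdotE (rdotC (g i)); lra.
Qed.

Let ip f g : R[i] := limn (fun n => complex.Re (psum f g n)) +i*
                     limn (fun n => complex.Im (psum f g n)).

Let ip_ccvg f g : dom f -> dom g -> ccvg (psum f g) (ip f g).
Proof.
move=> df dg; split=> /=; first exact: Re_psum_cvg.
have di : dom ('i *: g) by rewrite -[_ *: _]addr0; exact: domP.
have := Re_psum_cvg df di.
rewrite (_ : (fun n => _) = fun n => complex.Im (psum f g n))//.
apply/funext => n; rewrite /psum; elim/big_ind2 : _ => // [z1 x1 z2 x2|i _].
  by rewrite cReD cImD => -> ->.
by rewrite [in RHS]innerE.
Qed.

Let ip_linl a f g h : dom f -> dom g -> dom h ->
  ip (a *: f + g) h = a * ip f h + ip g h.
Proof.
move=> df dg dh; apply: ccvg_unique (ip_ccvg (domP a df dg) dh) _.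
rewrite (_ : psum _ _ = fun n => a * psum f h n + psum g h n).
  by apply: ccvgD; [apply: ccvgZ; exact: ip_ccvg|exact: ip_ccvg].
apply/funext => n; rewrite /psum mulr_sumr -big_split; apply: eq_bigr => i _ /=.
exact: inner_linl.
Qed.

Let ip_conj f g : dom f -> dom g -> ip f g = Num.conj (ip g f).
Proof.
move=> df dg; apply: ccvg_unique (ip_ccvg df dg) _.
rewrite (_ : psum _ _ = fun n => Num.conj (psum g f n)).
  by apply: ccvg_conj; exact: ip_ccvg.
apply/funext => n; rewrite /psum rmorph_sum; apply: eq_bigr => i _ /=.
exact: inner_conj.
Qed.

Let ipxx f : dom f -> ip f f = (limn (qsum f))%:C.
Proof.
move=> df; apply: ccvg_unique (ip_ccvg df df) _.
rewrite (_ : psum _ _ = fun n => (qsum f n)%:C); last exact/funext/psumxx.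
by split=> /=; [exact: qsum_cvg|exact: cvg_cst].
Qed.

Let qsum_le_ip f n : dom f -> qsum f n <= complex.Re (ip f f).
Proof.
by move=> df; rewrite ipxx//=; apply: nondecreasing_cvgn_le => //; exact: qsum_cvg.
Qed.

Let ip_le f c : dom f -> (forall n, qsum f n <= c) -> complex.Re (ip f f) <= c.
Proof.
move=> df fc; rewrite ipxx//=.
by apply: limr_le; [exact: qsum_cvg|near=> n; exact: fc].
Unshelve. all: by end_near. Qed.

Let qsum_ge f i : nsq (f i) <= qsum f i.+1.
Proof.
by rewrite /qsum big_ord_recr lerDr sumr_ge0// => j _; exact: nsq_ge0.
Qed.

Let ip_gt0 f : dom f -> f != 0 -> 0 < ip f f.
Proof.
move=> df f0; rewrite (ipxx df) ltcR.
have [i fi] : exists i, f i != 0.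
  apply: contrapT => h; move/eqP: f0; apply; apply/funext => i.
  by apply/eqP; apply: contrapT => /negP fi; apply: h; exists i.
have : 0 < nsq (f i).
  by rewrite lt_def nsq_ge0 andbT; apply: contra_neq fi; exact: nsq_eq0.
move=> /lt_le_trans; apply; apply: (le_trans (qsum_ge f i)).
by have := qsum_le_ip i.+1 df; rewrite (ipxx df).
Qed.

(** The limit is taken coordinate by coordinate. Finite partial sums pass to the
    limit first, and the bound that they satisfy does not depend on their length. *)
Let ip_complete (u : nat -> nat -> H) : (forall n, dom (u n)) ->
  (forall e : R, 0 < e -> exists N, forall m n, (N <= m)%N -> (N <= n)%N ->
     complex.Re (ip (u m - u n) (u m - u n)) < e) ->
  exists2 l, dom l & forall e : R, 0 < e -> exists N, forall n, (N <= n)%N ->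
     complex.Re (ip (u n - l) (u n - l)) < e.
Proof.
move=> du uc.
have domB f g : dom f -> dom g -> dom (f - g).
  by move=> df dg; rewrite -scaleN1r addrC; exact: domP.
have /choice[l lP] : forall i, exists x, tendsto (fun n => u n i) x.
  move=> i; apply: hilbert_complete => e /uc[N HN]; exists N => m n Nm Nn.
  apply: le_lt_trans (HN m n Nm Nn).
  apply: (le_trans (qsum_ge (u m - u n) i)).
  by apply: qsum_le_ip; exact: domB.
have key e : 0 < e -> exists N, forall k n, (N <= k)%N -> qsum (u k - l) n <= e.
  move=> /uc[N HN]; exists N => k n Nk.
  have c1 : (fun m => qsum (u k - u m) n) @ \oo --> qsum (u k - l) n.
    rewrite /qsum; elim: n => [|n IH].
      rewrite big_ord0 (_ : (fun m => _) = fun=> 0); first exact: cvg_cst.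
      by apply/funext => m; rewrite big_ord0.
    rewrite big_ord_recr (_ : (fun m => _) = fun m =>
        \sum_(i < n) nsq ((u k - u m) i) + nsq (u k n - u m n)); last first.
      by apply/funext => m; rewrite big_ord_recr.
    apply: cvgD; first exact: IH.
    by apply: nsq_cvg; apply: tendstoD; [exact: tendsto_cst|apply: tendstoN; exact: lP].
  apply: (ler_cvg_to c1 (cvg_cst e)); near=> m.
  apply: (le_trans (qsum_le_ip n (domB _ _ (du k) (du m)))); apply: ltW; apply: HN => //.
  by near: m; exists N.
have dl : dom l.
  have [N HN] := key 1 ltr01; rewrite (_ : l = u N - (u N - l)); last by rewrite subKr.
  by apply: domB => //; exists 1 => n; exact: HN.
exists l => // e e0; have [|N HN] := key (e / 2); first by rewrite divr_gt0.
exists N => k Nk; apply: (@le_lt_trans _ _ (e / 2)); last lra.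
by apply: ip_le => [|n]; [exact: domB|exact: HN].
Unshelve. all: by end_near. Qed.

Definition l2_data : hilbert_data R := @HilbertData R (nat -> H) dom ip
  dom0 domP ip_linl ip_conj ip_gt0 ip_complete.

Definition l2 : hilbertType R := hilbert_of l2_data.

Let cons_fun (x : H) f : nat -> H := fun n => if n is m.+1 then f m else x.

Let dom_cons x f : dom f -> dom (cons_fun x f).
Proof.
move=> [M fM]; exists (nsq x + `|M|) => -[|n].
  by rewrite big_ord0 addr_ge0// nsq_ge0.
by rewrite big_ord_recl lerD2l (le_trans (fM n))// ler_norm.
Qed.

Let dom_tail f : dom f -> dom (fun n => f n.+1).
Proof.
move=> [M fM]; exists M => n; apply: le_trans (fM n.+1).
by rewrite big_ord_recl lerDr nsq_ge0.
Qed.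

Definition lcons (x : H) (f : l2) : l2 := @hmk R l2_data _ (dom_cons x (@hvalP R l2_data f)).
Definition lhead (f : l2) : H := @hval R l2_data f 0%N.
Definition ltail (f : l2) : l2 := @hmk R l2_data _ (dom_tail (@hvalP R l2_data f)).

Implicit Types u v : l2.

Lemma lhead_cons x u : lhead (lcons x u) = x. Proof. by []. Qed.

Lemma ltail_cons x u : ltail (lcons x u) = u. Proof. exact: val_inj. Qed.

Lemma lconsP a x u y v : lcons (a *: x + y) (a *: u + v) = a *: lcons x u + lcons y v.
Proof. by apply: val_inj; apply/funext => -[|n]. Qed.

Lemma lhead_linear : linear lhead. Proof. by []. Qed.

Lemma ltail_linear : linear ltail. Proof. by move=> a u v; exact: val_inj. Qed.

(** Head and tail identify the sequence space with the orthogonal sum of H and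
    itself; no other property of sequences is used below. *)
Lemma l2_inner u v : '[u, v] = '[lhead u, lhead v] + '[ltail u, ltail v].
Proof.
have c1 := ip_ccvg (@hvalP R l2_data u) (@hvalP R l2_data v).
have c2 := ip_ccvg (@hvalP R l2_data (ltail u)) (@hvalP R l2_data (ltail v)).
have c3 : ccvg (fun=> '[lhead u, lhead v]) '[lhead u, lhead v].
  by split; exact: cvg_cst.
apply: ccvg_unique (ccvgD c3 c2).
have [h1 h2] := c1; pose p n := psum (@hval R l2_data u) (@hval R l2_data v) n.
have pE : (fun n => '[lhead u, lhead v] +
    psum (@hval R l2_data (ltail u)) (@hval R l2_data (ltail v)) n) = fun n => p n.+1.
  by apply/funext => n; rewrite /p /psum big_ord_recl.
rewrite pE; split.
  by have := h1; rewrite -(cvg_shiftS (fun n => complex.Re (p n))).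
by have := h2; rewrite -(cvg_shiftS (fun n => complex.Im (p n))).
Qed.

Lemma l2_rdot u v : rdot u v = rdot (lhead u) (lhead v) + rdot (ltail u) (ltail v).
Proof. by rewrite /rdot /redot -cReD -l2_inner. Qed.

End SquareSummable.

(** * Concave operators and their invariant majorants *)

Section Concave.
Variable R : realType.
Implicit Types H K : hilbertType R.

Lemma rdot_i H (x : H) : rdot x ('i *: x) = 0.
Proof. by have := innerxx x; rewrite innerE => -[]. Qed.

Lemma inner_real H (u x : H) : rdot u ('i *: x) = 0 -> '[u, x] = (rdot u x)%:C.
Proof. by move=> h; rewrite innerE h. Qed.

Lemma adjointPl H K (T : 'B(H, K)) x y : '[adjoint T y, x] = '[y, T x].
Proof. by rewrite inner_conj -adjointP -inner_conj. Qed.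

Lemma sqrt_form H (B : 'B(H)) : selfadj B -> psd B ->
  exists2 Z : 'B(H), selfadj Z & forall x, nsq (Z x) = rdot (B x) x.
Proof.
by move=> sB /(sqrt_op sB)[Z [sZ _ ZZ]]; exists Z => // x; rewrite -ZZ sZ sZ.
Qed.

Lemma Delta_rdot H (T : 'B(H)) x y :
  rdot (Delta T x) y = rdot (T x) (T y) - rdot x y.
Proof. by rewrite /Delta !rdotE rdot_adjl. Qed.

Lemma Delta_linear H (T : 'B(H)) : linear (Delta T).
Proof.
move=> a x y; rewrite /Delta linearP adjoint_linear scalerBr.
by rewrite opprD addrACA.
Qed.

Lemma Delta_bounded_ex H (T : 'B(H)) : exists c, forall x, nsq (Delta T x) <= c * nsq x.
Proof.
have [c c0 hc] := bop_bounded (badd (bcomp (badj T) T) (bscale H (-1))).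
exists c => x; have := hc x.
by rewrite !bopE rmorphN rmorph1 scaleN1r.
Qed.

Definition bDelta H (T : 'B(H)) : 'B(H) :=
  bop_of (Delta_linear T) (projT2 (cid (Delta_bounded_ex T))).

Lemma bDelta_rdot H (T : 'B(H)) x y :
  rdot (bDelta T x) y = rdot (T x) (T y) - rdot x y.
Proof. exact: Delta_rdot. Qed.

Lemma bDelta_selfadj H (T : 'B(H)) : selfadj (bDelta T).
Proof. by move=> x y; rewrite bDelta_rdot [RHS]rdotC bDelta_rdot !(rdotC y) (rdotC (T y)). Qed.

Lemma second_defect_rdot H (T : 'B(H)) x y : rdot (second_defect T x) y =
  rdot (T (T x)) (T (T y)) - 2 * rdot (T x) (T y) + rdot x y.
Proof. by rewrite /second_defect mulr2n !rdotE !rdot_adjl; ring. Qed.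

Lemma concaveP H (T : 'B(H)) : concave T <->
  forall x, nsq (T (T x)) - 2 * nsq (T x) + nsq x <= 0.
Proof.
have key x : '[second_defect T x, x] =
    (nsq (T (T x)) - 2 * nsq (T x) + nsq x)%:C.
  rewrite inner_real ?second_defect_rdot// !linearZ /= !rdot_i; lra.
have z x : '[0 : H, x] = 0%:C by rewrite inner_real ?rdot0l.
by split=> h x; have := h x; rewrite key z lecR.
Qed.

Lemma two_isometryP H (T : 'B(H)) :
  (forall x y, rdot (T (T x)) (T (T y)) - 2 * rdot (T x) (T y) + rdot x y = 0) ->
  two_isometry T.
Proof.
move=> h x; apply: rdot_ext => z.
by rewrite rdot0r rdotC second_defect_rdot h.
Qed.

(** The increments of n |-> |T^n x|^2 decrease. If the first one were negative, this
    sequence would tend to -oo. *)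
Lemma concave_expansive H (T : 'B(H)) : concave T -> forall x, nsq x <= nsq (T x).
Proof.
move=> /concaveP cT x; rewrite leNgt; apply/negP => lt.
pose a n := nsq (iter n T x).
have da n : a n.+1 - a n <= nsq (T x) - nsq x.
  elim: n => [|n IH]; first by [].
  by apply: le_trans IH; have := cT (iter n T x); rewrite /a /=; lra.
have an n : a n <= nsq x + n%:R * (nsq (T x) - nsq x).
  elim: n => [|n IH]; first by rewrite mul0r addr0.
  by have := da n; rewrite -natr1; lra.
have d0 : 0 < nsq x - nsq (T x) by rewrite subr_gt0.
have [n Nn] : exists n, nsq x / (nsq x - nsq (T x)) < n%:R.
  exists (Num.bound (nsq x / (nsq x - nsq (T x)))).
  by apply: archi_boundP; rewrite divr_ge0 ?nsq_ge0 ?ltW.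
move: Nn; rewrite ltr_pdivrMr// => Nn.
have := nsq_ge0 (iter n T x); rewrite -/(a n) => a0.
by have := an n; lra.
Qed.

Lemma bDelta_psd H (T : 'B(H)) : concave T -> psd (bDelta T).
Proof. by move=> /concave_expansive eT x; rewrite bDelta_rdot subr_ge0. Qed.

(** With B = (I - X)^(1/2) and Z = (X - T^*XT)^(1/2), the hypotheses give
    |Z h|^2 <= <X h, h> - <X T h, T h> <= |T h|^2 - <X T h, T h> = |B T h|^2, hence
    a contraction G with G B T = Z. Then X' = X + (G B)^*G B stays below
    X + B^2 = I, and T^*X'T = T^*XT + Z^2 = X. *)
Lemma majorant_step H (T X : 'B(H)) : (forall x, nsq x <= nsq (T x)) ->
  selfadj X -> (forall x, rdot (X x) x <= nsq x) ->
  (forall x, rdot (X (T x)) (T x) <= rdot (X x) x) ->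
  exists X' : 'B(H), [/\ selfadj X', forall x, rdot (X x) x <= rdot (X' x) x,
    forall x, rdot (X' x) x <= nsq x &
    forall x, rdot (X' (T x)) (T x) = rdot (X x) x].
Proof.
move=> eT sX X1 XT.
pose D1 := badd (bscale H 1) (bcomp (bscale H (-1)) X).
have D1E x : rdot (D1 x) x = nsq x - rdot (X x) x.
  by rewrite !bopE !rdotE; ring.
have [||B sB BE] := @sqrt_form _ D1.
- by apply: selfadj_badd; [exact: selfadj_bscale|exact: selfadj_bscaleM].
- by move=> x; rewrite D1E subr_ge0.
pose D2 := badd X (bcomp (bscale H (-1)) (bcomp (badj T) (bcomp X T))).
have D2E x : rdot (D2 x) x = rdot (X x) x - rdot (X (T x)) (T x).
  by rewrite !bopE !rdotE rdot_adjl; ring.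
have [||Z sZ ZE] := @sqrt_form _ D2.
- by apply: selfadj_badd => //; apply: selfadj_bscaleM; exact: selfadj_conj.
- by move=> x; rewrite D2E subr_ge0.
have [|G [GE G1 _]] := @douglas _ _ _ _ Z (bcomp B T).
  move=> h; rewrite ZE bcompE BE D1E D2E.
  by have := X1 h; have := eT h; lra.
pose GB := bcomp G B.
exists (badd X (bcomp (badj GB) GB)).
have E x : rdot (badd X (bcomp (badj GB) GB) x) x = rdot (X x) x + nsq (G (B x)).
  by rewrite !bopE rdotDl rdot_adjl.
split=> [|x|x|x].
- by apply: selfadj_badd => //; exact: selfadj_badj.
- by rewrite E lerDl nsq_ge0.
- by rewrite E; have := G1 (B x); rewrite BE D1E; lra.
- by rewrite E (GE x) ZE D2E; ring.
Qed.

(** Iterate [majorant_step] from A. The relation T^*X'T = X between successive terms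
    shows that each term satisfies the hypotheses of the step, and becomes the
    invariance of the limit. *)
Lemma invariant_majorant H (T A : 'B(H)) : (forall x, nsq x <= nsq (T x)) ->
  selfadj A -> psd A -> (forall x, rdot (A x) x <= nsq x) ->
  (forall x, rdot (A (T x)) (T x) <= rdot (A x) x) ->
  exists Q : 'B(H), [/\ selfadj Q, forall x, rdot (A x) x <= rdot (Q x) x,
    forall x, rdot (Q x) x <= nsq x &
    forall x, rdot (Q (T x)) (T x) = rdot (Q x) x].
Proof.
move=> eT sA pA A1 AT.
pose ok (X : 'B(H)) := [/\ selfadj X, forall x, rdot (X x) x <= nsq x &
  forall x, rdot (X (T x)) (T x) <= rdot (X x) x].
have /choice[s sP] : forall X : 'B(H), exists X' : 'B(H), ok X ->
    [/\ ok X', forall x, rdot (X x) x <= rdot (X' x) x &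
        forall x, rdot (X' (T x)) (T x) = rdot (X x) x].
  move=> X; case: (pselect (ok X)) => [[sX X1 XT]|nX]; last by exists X.
  have [X' [sX' XX' X'1 X'T]] := majorant_step eT sX X1 XT.
  by exists X' => _; split=> //; split=> // x; rewrite X'T.
pose X n := iter n s A.
have okX n : ok (X n) by elim: n => [//|n /sP[]].
have Xmon n x : rdot (X n x) x <= rdot (X n.+1 x) x by have [_] := sP _ (okX n).
have XT n x : rdot (X n.+1 (T x)) (T x) = rdot (X n x) x by have [_ _] := sP _ (okX n).
have AX n x : rdot (A x) x <= rdot (X n x) x.
  by elim: n => [//|n IH]; exact: le_trans (Xmon n x).
have [|||||Q [sQ QX]] := @monotone_limit _ _ X 1.
- by move=> n; have [] := okX n.
- by move=> n x; exact: le_trans (AX n x).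
- exact: ler01.
- exact: Xmon.
- by move=> n x; rewrite mul1r; have [_ ->] := okX n.
exists Q; split=> // [x|x|x].
- apply: (ler_cvg_to (cvg_cst _) (rdot_cvgl (QX x))); near=> n; exact: AX.
- apply: (ler_cvg_to (rdot_cvgl (QX x)) (cvg_cst _)); near=> n.
  by have [_ ->] := okX n.
- have c1 : (fun n => rdot (X n.+1 (T x)) (T x)) @ \oo --> rdot (Q (T x)) (T x).
    have := @rdot_cvgl _ _ _ _ (T x) (QX (T x)).
    by rewrite -(cvg_shiftS (fun n => rdot (X n (T x)) (T x))).
  apply: (cvg_unique (@Rhausdorff R) c1).
  rewrite (_ : (fun n => _) = fun n => rdot (X n x) x); first exact: rdot_cvgl.
  by apply/funext => n; rewrite XT.
Unshelve. all: by end_near. Qed.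

(** [invariant_majorant] applied to Delta T divided by its norm d. When d = 0 the
    inverse of d is 0 by convention, the starting point is 0 and the last inequality
    holds because Delta T is then 0. *)
Lemma concave_majorant H (T : 'B(H)) : concave T ->
  exists Q : 'B(H), [/\ selfadj Q, psd Q, forall x, rdot (Q x) x <= nsq x,
    forall x, rdot (Q (T x)) (T x) = rdot (Q x) x &
    forall x, rdot (Delta T x) x <= opnorm (Delta T) * rdot (Q x) x].
Proof.
move=> cT; pose d := opnorm (Delta T).
have d0 : 0 <= d := opnorm_ge0 (bDelta T).
have Dd x : rdot (Delta T x) x <= d * nsq x := opnorm_quad (bDelta T) x.
pose A := bcomp (bscale H d^-1) (bDelta T).
have AE x : rdot (A x) x = d^-1 * rdot (Delta T x) x.
  by rewrite !bopE rdotZl.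
have pD x : 0 <= rdot (Delta T x) x := bDelta_psd cT x.
have [|||||Q [sQ AQ Q1 QT]] := @invariant_majorant _ T A.
- exact: concave_expansive.
- by apply: selfadj_bscaleM; exact: bDelta_selfadj.
- by move=> x; rewrite AE mulr_ge0// invr_ge0.
- move=> x; rewrite AE; have [->|dn] := eqVneq d 0.
    by rewrite invr0 mul0r nsq_ge0.
  by rewrite ler_pdivrMl ?Dd// lt_def dn.
- move=> x; rewrite !AE ler_wpM2l ?invr_ge0// !Delta_rdot.
  by have := (concaveP T).1 cT x; lra.
exists Q; split=> // x.
  by apply: le_trans (AQ x); rewrite AE mulr_ge0// invr_ge0.
rewrite -/d; have [d00|dn] := eqVneq d 0.
  by have := Dd x; rewrite d00 !mul0r.
by have := AQ x; rewrite AE ler_pdivrMl// lt_def dn.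
Qed.

End Concave.

(** * Isometric dilation of contractions *)

Section Shift.
Variables (R : realType) (K : hilbertType R).

Lemma lhead_bounded (x : l2 K) : nsq (lhead x) <= 1 * nsq x.
Proof. by rewrite mul1r [leRHS]l2_rdot lerDl nsq_ge0. Qed.

Definition bhead : 'B(l2 K, K) := bop_of (@lhead_linear R K) lhead_bounded.

Lemma lemb_linear : linear (fun k : K => lcons k 0).
Proof. by move=> a x y; rewrite -lconsP scaler0 addr0. Qed.

Lemma lemb_bounded (k : K) : nsq (lcons k 0) <= 1 * nsq k.
Proof. by rewrite mul1r l2_rdot lhead_cons ltail_cons rdot0l addr0. Qed.

Definition lemb : 'B(K, l2 K) := bop_of lemb_linear lemb_bounded.

Lemma lemb_rdot k x : rdot (lemb k) x = rdot k (lhead x).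
Proof. by rewrite l2_rdot lhead_cons ltail_cons rdot0l addr0. Qed.

Variables C D : 'B(K).

Let f (x : l2 K) : l2 K := lcons (C (lhead x)) (lcons (D (lhead x)) (ltail x)).

Let f_linear : linear f.
Proof.
by move=> a x y; rewrite /f lhead_linear ltail_linear !linearP -!lconsP.
Qed.

Let f_rdot x y : rdot (f x) (f y) = rdot (C (lhead x)) (C (lhead y)) +
  rdot (D (lhead x)) (D (lhead y)) + rdot x y - rdot (lhead x) (lhead y).
Proof.
rewrite l2_rdot !lhead_cons !ltail_cons [X in _ + X]l2_rdot !lhead_cons !ltail_cons.
by rewrite (l2_rdot x y); ring.
Qed.

Let f_bounded : exists c, forall x, nsq (f x) <= c * nsq x.
Proof.
have [[c c0 hc] [d d0 hd]] := (bop_bounded C, bop_bounded D).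
exists (c + d + 1) => x; rewrite f_rdot.
have := hc (lhead x); have := hd (lhead x); have := lhead_bounded x.
have := nsq_ge0 (lhead x); move: (nsq x) (nsq (lhead x)) => q p p0 pq.
rewrite mul1r in pq; have := ler_wpM2l c0 pq; have := ler_wpM2l d0 pq; lra.
Qed.

(** The operator (k0, k1, ...) |-> (C k0, D k0, k1, k2, ...). Both the 2-isometric
    lifting and the isometric dilations have this form. *)
Definition head_shift : 'B(l2 K) := bop_of f_linear (projT2 (cid f_bounded)).

Lemma head_shiftE x :
  head_shift x = lcons (C (lhead x)) (lcons (D (lhead x)) (ltail x)).
Proof. by []. Qed.

Lemma head_shift_rdot x y : rdot (head_shift x) (head_shift y) =
  rdot (C (lhead x)) (C (lhead y)) + rdot (D (lhead x)) (D (lhead y)) +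
  rdot x y - rdot (lhead x) (lhead y).
Proof. exact: f_rdot. Qed.

End Shift.

(** [head_shift G D] is isometric when D = (I - G^*G)^(1/2). On the vectors whose norm
    is preserved by G the defect D vanishes, so there the dilation is G itself. *)
Lemma isometric_dilation (R : realType) (K : hilbertType R) (G : 'B(K)) :
  (forall k, nsq (G k) <= nsq k) -> exists W : 'B(l2 K),
  [/\ isometric W, forall x, lhead (W x) = G (lhead x) &
      forall k, nsq (G k) = nsq k -> W (lemb K k) = lemb K (G k)].
Proof.
move=> G1; pose B := badd (bscale K 1) (bcomp (bscale K (-1)) (bcomp (badj G) G)).
have BE k : rdot (B k) k = nsq k - nsq (G k).
  by rewrite !bopE !rdotE rdot_adjl; ring.
have [||D _ DE] := @sqrt_form _ _ B.
- by apply: selfadj_badd; [exact: selfadj_bscale|apply: selfadj_bscaleM; exact: selfadj_badj].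
- by move=> k; rewrite BE subr_ge0.
exists (head_shift G D); split=> [|//|k Gk].
  by apply: isometricP => x; rewrite head_shift_rdot DE BE; ring.
rewrite head_shiftE lhead_cons ltail_cons.
have -> : D k = 0 by apply: nsq_eq0; rewrite DE BE Gk subrr.
have lcons0 : lcons (0 : K) 0 = 0 by exact: (linear0 (lemb K)).
by rewrite lcons0.
Qed.

Section Subspaces.
Variable R : realType.

Lemma closed_subspace_smallest (K : hilbertType R) (G : set K) :
  closed_subspace (smallest (@closed_subspace R K) G).
Proof.
split.
- apply/closed_tendsto => u x Fu ux A [cA GA]; case: (cA) => /closed_tendsto cl _ _.
  by apply: (cl u) => // n; apply: Fu.
- by move=> A [[_ A0 _] _].
- by move=> a x y Fx Fy A AG; case: (AG) => -[_ _ AP] _; apply: AP; [exact: Fx|exact: Fy].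
Qed.

Variables (K : hilbertType R) (F : set K).
Hypothesis cF : closed_subspace F.
Local Notation M := (subspace cF).

Definition subval (x : M) : K := @hval R (subspace_data cF) x.

Lemma subvalP x : F (subval x). Proof. exact: (@hvalP R (subspace_data cF) x). Qed.

Definition submk x (Fx : F x) : M := @hmk R (subspace_data cF) x Fx.

Lemma submkK x (Fx : F x) : subval (submk Fx) = x. Proof. by []. Qed.

Lemma subval_inj : injective subval. Proof. exact: val_inj. Qed.

Lemma subval_rdot x y : rdot x y = rdot (subval x) (subval y). Proof. by []. Qed.

Lemma subvalB x y : subval (x - y) = subval x - subval y. Proof. by []. Qed.

Lemma corestrict_linear (H : hilbertType R) (A : 'B(H, K)) (AF : forall h, F (A h)) :
  linear (fun h => submk (AF h)).
Proof. by move=> a x y; apply: subval_inj; exact: (linearP A a x y). Qed.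

Lemma corestrict_bounded (H : hilbertType R) (A : 'B(H, K)) (AF : forall h, F (A h)) :
  exists c, forall h, nsq (submk (AF h)) <= c * nsq h.
Proof. by have [c _ hc] := bop_bounded A; exists c => h; exact: (hc h). Qed.

Definition corestrict (H : hilbertType R) (A : 'B(H, K)) (AF : forall h, F (A h)) : 'B(H, M) :=
  bop_of (corestrict_linear AF) (projT2 (cid (corestrict_bounded AF))).

Lemma subval_linear : linear subval. Proof. by []. Qed.

Lemma subval_bounded x : nsq (subval x) <= 1 * nsq x.
Proof. by rewrite mul1r. Qed.

Definition binc : 'B(M, K) := bop_of subval_linear subval_bounded.

End Subspaces.

(** * The minimal 2-isometric lifting *)

Section Lifting.
Variable R : realType.
Implicit Types H K : hilbertType R.

Lemma opnorm_Delta_le H K (J : 'B(H, K)) (T : 'B(H)) (S : 'B(K)) :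
  isometric J -> concave T ->
  (forall h, rdot (Delta T h) h <= rdot (Delta S (J h)) (J h)) ->
  opnorm (Delta T) <= opnorm (Delta S).
Proof.
move=> JJ cT TS; apply: (@opnorm_psd_le _ _ (bDelta T)).
- exact: bDelta_selfadj.
- exact: bDelta_psd.
- exact: (opnorm_ge0 (bDelta S)).
- move=> h; apply: (le_trans (TS h)).
  by rewrite -(isometric_rdot h h JJ); exact: (opnorm_quad (bDelta S)).
Qed.

(** Here [YE] says that Y^*Y = d Q - Delta T. *)
Section Construction.
Variables (H : hilbertType R) (T Q Y : 'B(H)) (d : R).
Hypotheses (sQ : selfadj Q) (d0 : 0 <= d) (QT : forall x, rdot (Q (T x)) (T x) = rdot (Q x) x).
Hypothesis YE : forall x y,
  rdot (Y x) (Y y) = d * rdot (Q x) y - (rdot (T x) (T y) - rdot x y).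

Let S := head_shift T Y.

(* S^*S - I is d Q on the head and 0 on the tail *)
Let S_rdot x y : rdot (S x) (S y) = rdot x y + d * rdot (Q (lhead x)) (lhead y).
Proof. by rewrite head_shift_rdot YE; ring. Qed.

Let QT_rdot x y : rdot (Q (T x)) (T y) = rdot (Q x) y.
Proof.
have := selfadj_polar (T x) (T y) sQ; rewrite -linearD !QT.
by have := selfadj_polar x y sQ; lra.
Qed.

Let G := \bigcup_n range (fun h : H => iter n S (lemb H h)).
Let F := smallest (@closed_subspace R (l2 H)) G.
Let cF : closed_subspace F := closed_subspace_smallest G.

Let F_sub A : closed_subspace A -> G `<=` A -> F `<=` A.
Proof. by move=> cA GA x; apply. Qed.

Let G_F : G `<=` F.
Proof. by move=> x Gx A [_]; apply. Qed.

Let F_S x : F x -> F (S x).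
Proof.
move: x; apply: F_sub; last first.
  by move=> _ [n _ [h _ <-]]; apply: G_F; exists n.+1 => //; exists h.
have [/closed_tendsto cl F0 FP] := cF; split.
- apply/closed_tendsto => u x Fu ux; apply: (cl (fun n => S (u n))) => //.
  exact: tendsto_bop.
- by change (F (S 0)); rewrite linear0.
- by move=> a x y Fx Fy; change (F (S (a *: x + y))); rewrite linearP; exact: FP.
Qed.

Let emb_F h : F (lemb H h). Proof. by apply: G_F; exists 0%N => //; exists h. Qed.

(** The closed span of the orbits of H under S: S leaves it invariant, and the type I
    and 2-isometry conditions pass to the restriction. *)
Definition lift_space : hilbertType R := subspace cF.

Definition lift_emb : 'B(H, lift_space) := corestrict cF emb_F.

Let binc_F (x : lift_space) : F (bcomp S (binc cF) x).
Proof. by apply: F_S; exact: subvalP. Qed.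

Definition lift_op : 'B(lift_space) := corestrict cF binc_F.

Let hd (x : lift_space) : H := lhead (subval x).

Lemma lift_op_rdot x y : rdot (lift_op x) (lift_op y) = rdot x y + d * rdot (Q (hd x)) (hd y).
Proof. exact: S_rdot. Qed.

Lemma lift_emb_rdot h x : rdot (lift_emb h) x = rdot h (hd x).
Proof. exact: lemb_rdot. Qed.

Lemma hd_lift_op x : hd (lift_op x) = T (hd x).
Proof. by []. Qed.

Lemma lift_emb_isometric : isometric lift_emb.
Proof. by apply: isometricP => h; rewrite lift_emb_rdot. Qed.

Lemma lift_op_lifting : lifting lift_emb T lift_op.
Proof.
split; first exact: lift_emb_isometric.
have hdE x : adjoint lift_emb x = hd x.
  by apply: rdot_ext => z; rewrite rdot_adj lift_emb_rdot.
by move=> x; rewrite !hdE hd_lift_op.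
Qed.

Lemma lift_op_two_isometry : two_isometry lift_op.
Proof.
apply: two_isometryP => x y.
by rewrite !lift_op_rdot !hd_lift_op QT_rdot; ring.
Qed.

Lemma lift_op_type_I : type_I lift_emb lift_op.
Proof.
move=> x xH; have hx : hd x = 0.
  apply: nsq_eq0; rewrite -lift_emb_rdot rdotC.
  exact: (congr1 (@complex.Re R) (xH (hd x))).
apply: rdot_ext => z.
by rewrite rdot0r rdotC Delta_rdot lift_op_rdot hx linear0 rdot0l; ring.
Qed.

(** A closed subspace of [lift_space] that contains the orbits is also a closed
    subspace of the sequence space, hence contains their closed span. *)
Lemma lift_op_minimal : minimal_lifting lift_emb lift_op.
Proof.
apply/seteqP; split=> // x _ A [cA GA].
have [/closed_tendsto clF F0 FP] := cF; have [/closed_tendsto clA A0 AP] := cA.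
suff : F `<=` [set subval a | a in A].
  by move=> /(_ _ (subvalP x))[a Aa] /subval_inj <-.
have iterE n h : subval (iter n lift_op (lift_emb h)) = iter n S (lemb H h).
  by elim: n => //= n <-.
apply: F_sub; last first.
  move=> _ [n _ [h _ <-]]; exists (iter n lift_op (lift_emb h)) => //.
  by apply: GA; exists n => //; exists h.
split.
- apply/closed_tendsto => u y uA uy.
  have /choice[v vP] : forall n, exists a, A a /\ subval a = u n.
    by move=> n; have [a] := uA n; exists a.
  have uE n : subval (v n) = u n by have [] := vP n.
  have Fy : F y by apply: (clF u) => // n; rewrite -uE; exact: subvalP.
  exists (submk cF Fy) => //; apply: (clA v) => [n|]; first by have [] := vP n.
  rewrite /tendsto (_ : (fun n => nsq _) = fun n => nsq (u n - y)); first exact: uy.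
  by apply/funext => n; rewrite subval_rdot subvalB submkK uE.
- by exists 0.
- move=> a _ _ [y Ay <-] [z Az <-]; exists (a *: y + z) => //.
  exact: AP.
Qed.

Lemma lift_op_opnorm : (forall x, 0 <= rdot (Q x) x <= nsq x) ->
  opnorm (Delta lift_op) <= d.
Proof.
move=> Q1.
have DE x : rdot (bDelta lift_op x) x = d * rdot (Q (hd x)) (hd x).
  by rewrite bDelta_rdot lift_op_rdot; ring.
apply: (@opnorm_psd_le _ _ (bDelta lift_op)) => //.
- exact: bDelta_selfadj.
- by move=> x; rewrite DE mulr_ge0//; have /andP[] := Q1 (hd x).
- move=> x; rewrite DE ler_wpM2l//; have /andP[_ h] := Q1 (hd x).
  apply: (le_trans h); rewrite -[leRHS]mul1r; exact: lhead_bounded.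
Qed.

End Construction.

Theorem concave_lifting H (T : 'B(H)) : concave T ->
  exists (K : hilbertType R) (J : 'B(H, K)) (S : 'B(K)),
    [/\ lifting J T S, two_isometry S, minimal_lifting J S, type_I J S
      & sqrt_norm_Delta S = sqrt_norm_Delta T].
Proof.
move=> cT; pose d := opnorm (Delta T).
have d0 : 0 <= d := opnorm_ge0 (bDelta T).
have [Q [sQ pQ Q1 QT QD]] := concave_majorant cT.
pose B := badd (bcomp (bscale H d) Q) (bcomp (bscale H (-1)) (bDelta T)).
have BE x y : rdot (B x) y = d * rdot (Q x) y - (rdot (T x) (T y) - rdot x y).
  by rewrite /B !bopE !rdotE rdot_adjl; ring.
have [||Y [sY _ YY]] := @sqrt_op _ _ B.
- apply: selfadj_badd; apply: selfadj_bscaleM => //; exact: bDelta_selfadj.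
- by move=> x; rewrite BE subr_ge0 -Delta_rdot QD.
have YE x y : rdot (Y x) (Y y) = d * rdot (Q x) y - (rdot (T x) (T y) - rdot x y).
  by rewrite -sY YY BE.
exists (lift_space T Y), (lift_emb T Y), (lift_op T Y); split.
- exact: lift_op_lifting.
- exact: (lift_op_two_isometry sQ QT YE).
- exact: lift_op_minimal.
- exact: (lift_op_type_I YE).
- congr Num.sqrt; apply/eqP; rewrite eq_le; apply/andP; split.
    by apply: (lift_op_opnorm d0 YE) => x; rewrite Q1 andbT; exact: pQ.
  apply: (opnorm_Delta_le (lift_emb_isometric T Y) cT) => h.
  rewrite [leRHS]Delta_rdot (lift_op_rdot YE).
  by have := QD h; rewrite addrAC subrr add0r.
Qed.

End Lifting.

(** * The triangular extension *)

Section DirectSumOps.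
Variables (R : realType) (H K : hilbertType R).

Lemma dinl_linear : linear (fun x : H => dpair x (0 : K)).
Proof. by move=> a x y; rewrite -dpairP scaler0 addr0. Qed.

Lemma dinl_bounded (x : H) : nsq (dpair x (0 : K)) <= 1 * nsq x.
Proof. by rewrite dsum_rdot /= rdot0l addr0 mul1r. Qed.

Definition dinl : 'B(H, dsum H K) := bop_of dinl_linear dinl_bounded.

Lemma dinr_linear : linear (fun y : K => dpair (0 : H) y).
Proof. by move=> a x y; rewrite -dpairP scaler0 addr0. Qed.

Lemma dinr_bounded (y : K) : nsq (dpair (0 : H) y) <= 1 * nsq y.
Proof. by rewrite dsum_rdot /= rdot0l add0r mul1r. Qed.

Definition dinr : 'B(K, dsum H K) := bop_of dinr_linear dinr_bounded.

Lemma dfst_bounded (z : dsum H K) : nsq (dfst z) <= 1 * nsq z.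
Proof. by rewrite mul1r [leRHS]dsum_rdot lerDl nsq_ge0. Qed.

Definition bfst : 'B(dsum H K, H) := bop_of (@dfst_linear R H K) dfst_bounded.

Lemma dsnd_bounded (z : dsum H K) : nsq (dsnd z) <= 1 * nsq z.
Proof. by rewrite mul1r [leRHS]dsum_rdot lerDr nsq_ge0. Qed.

Definition bsnd : 'B(dsum H K, K) := bop_of (@dsnd_linear R H K) dsnd_bounded.

Lemma dinl_rdot x x' : rdot (dinl x) (dinl x') = rdot x x'.
Proof. by rewrite dsum_rdot /= rdot0l addr0. Qed.

Lemma dinr_rdot y y' : rdot (dinr y) (dinr y') = rdot y y'.
Proof. by rewrite dsum_rdot /= rdot0l add0r. Qed.

Lemma dinlr_rdot x y : rdot (dinl x) (dinr y) = 0.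
Proof. by rewrite dsum_rdot /= rdot0l rdot0r addr0. Qed.

Lemma bfstK x y : bfst (dinl x + dinr y) = x.
Proof. by rewrite linearD [X in X + _]/= [X in _ + X]/=; exact: addr0. Qed.

Lemma bsndK x y : bsnd (dinl x + dinr y) = y.
Proof. by rewrite linearD [X in X + _]/= [X in _ + X]/=; exact: add0r. Qed.

Lemma dsum_orthogonal_sum : orthogonal_sum dinl dinr.
Proof.
split.
- by apply: isometricP => x; exact: dinl_rdot.
- by apply: isometricP => x; exact: dinr_rdot.
- by move=> x y; rewrite innerE -linearZ !dinlr_rdot.
- move=> z; exists (dfst z), (dsnd z); rewrite -[LHS]dpairK.
  by rewrite -[dinl _ + _]dpairK [dfst (_ + _)]bfstK [dsnd (_ + _)]bsndK.
Qed.

End DirectSumOps.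

Section Extension.
Variable R : realType.
Implicit Types H K M : hilbertType R.

Lemma sqr_sqrt_norm_Delta H (T : 'B(H)) : sqrt_norm_Delta T ^+ 2 = opnorm (Delta T).
Proof. by rewrite sqr_sqrtr//; exact: (opnorm_ge0 (bDelta T)). Qed.

Lemma sqrt_norm_Delta_ge0 H (T : 'B(H)) : 0 <= sqrt_norm_Delta T.
Proof. exact: sqrtr_ge0. Qed.

Lemma contractiveP H K (A : 'B(H, K)) :
  contractive A <-> forall x, nsq (A x) <= nsq x.
Proof.
split=> [A1 x|A1].
  apply: (le_trans (opnorm_bound A x)); rewrite ler_piMl ?nsq_ge0//.
  by rewrite expr_le1// opnorm_ge0.
by apply: opnorm_le => // x; rewrite expr1n mul1r.
Qed.

Lemma ople_adjP H K (E : 'B(H, K)) (W : 'B(H)) :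
  ople (fun y => adjoint W (adjoint E (E (W y)))) (fun y => adjoint E (E y)) <->
  forall y, nsq (E (W y)) <= nsq (E y).
Proof.
have key y : ('[adjoint W (adjoint E (E (W y))), y] <= '[adjoint E (E y), y]) =
    (nsq (E (W y)) <= nsq (E y)).
  by rewrite !adjointPl !innerxx lecR.
by split=> h y; [rewrite -key; exact: h|rewrite [X in is_true X]key].
Qed.

Section Triangular.
Variables (M M0 M1 : hilbertType R) (J0 : 'B(M0, M)) (J1 : 'B(M1, M)) (T1 : 'B(M))
  (V : 'B(M0)) (E1 : 'B(M1, M0)) (W : 'B(M1)) (d : R).
Hypotheses (JJ : orthogonal_sum J0 J1)
  (T1E : forall x y, T1 (J0 x + J1 y) = J0 (V x + d%:C *: E1 y) + J1 (W y))
  (VV : isometric V) (WW : isometric W) (VE : forall y, adjoint V (E1 y) = 0).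

Lemma orthogonal_sum_nsq x y : nsq (J0 x + J1 y) = nsq x + nsq y.
Proof.
have [J0J J1J J01 _] := JJ.
have J01r : rdot (J0 x) (J1 y) = 0 by exact: (congr1 (@complex.Re R) (J01 x y)).
by rewrite !rdotE (rdotC (J1 y)) J01r (isometric_rdot _ _ J0J) (isometric_rdot _ _ J1J); ring.
Qed.

(** V x and E1 y are orthogonal because V^*E1 = 0, so the squared norms add up:
    T1^*T1 - I is d^2 E1^*E1 on M1 and 0 on M0. *)
Lemma triangular_nsq x y :
  nsq (T1 (J0 x + J1 y)) - nsq (J0 x + J1 y) = d ^+ 2 * nsq (E1 y).
Proof.
have VEr : rdot (V x) (E1 y) = 0 by rewrite -rdot_adj VE rdot0r.
rewrite T1E !orthogonal_sum_nsq !rdotE (rdotC (E1 y)) VEr.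
rewrite (isometric_rdot _ _ VV) (isometric_rdot _ _ WW); ring.
Qed.

Lemma triangular_iter n x y :
  exists x', iter n T1 (J0 x + J1 y) = J0 x' + J1 (iter n W y).
Proof.
elim: n => [|n [x' IH]]; first by exists x.
by exists (V x' + d%:C *: E1 (iter n W y)); rewrite /= IH T1E.
Qed.

Lemma triangular_growth n x y :
  nsq (iter n.+1 T1 (J0 x + J1 y)) - nsq (iter n T1 (J0 x + J1 y)) =
  d ^+ 2 * nsq (E1 (iter n W y)).
Proof. by have [x' E] := triangular_iter n x y; rewrite iterS E triangular_nsq. Qed.

Lemma triangular_concave : (forall y, nsq (E1 (W y)) <= nsq (E1 y)) -> concave T1.
Proof.
move=> EW; apply/concaveP => z; have [_ _ _ /(_ z)[x [y ->]]] := JJ.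
have h0 := triangular_growth 0 x y; have h1 := triangular_growth 1 x y.
have := ler_wpM2l (sqr_ge0 d) (EW y); rewrite /= in h0 h1; lra.
Qed.

Lemma triangular_opnorm : (forall y, nsq (E1 y) <= nsq y) ->
  opnorm (Delta T1) <= d ^+ 2.
Proof.
move=> E1c.
have DE x y : rdot (bDelta T1 (J0 x + J1 y)) (J0 x + J1 y) = d ^+ 2 * nsq (E1 y).
  by rewrite bDelta_rdot triangular_nsq.
have dec z : exists x y, z = J0 x + J1 y by have [_ _ _] := JJ; apply.
apply: (@opnorm_psd_le _ _ (bDelta T1)).
- exact: bDelta_selfadj.
- by move=> z; have [x [y ->]] := dec z; rewrite DE mulr_ge0 ?sqr_ge0 ?nsq_ge0.
- exact: sqr_ge0.
- move=> z; have [x [y ->]] := dec z; rewrite DE ler_wpM2l ?sqr_ge0//.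
  by rewrite (le_trans (E1c y))// orthogonal_sum_nsq lerDr nsq_ge0.
Qed.

End Triangular.

Lemma extension_iter H M (J : 'B(H, M)) (T : 'B(H)) (T1 : 'B(M)) n h :
  extension J T T1 -> nsq (iter n T1 (J h)) = nsq (iter n T h).
Proof.
move=> [JJ JT]; have -> : iter n T1 (J h) = J (iter n T h).
  by elim: n => //= n ->; rewrite JT.
by rewrite isometric_rdot.
Qed.

Lemma extension_concave H M (J : 'B(H, M)) (T : 'B(H)) (T1 : 'B(M)) :
  extension J T T1 -> concave T1 -> concave T.
Proof.
move=> JT /concaveP cT1; apply/concaveP => h.
have := cT1 (J h); have := extension_iter 0 h JT; have := extension_iter 1 h JT.
by have := extension_iter 2 h JT; rewrite /= => -> -> ->.
Qed.

(** By [triangular_nsq] the norm of Delta T1 is at most the one of Delta T, and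
    conversely Delta T is the compression of Delta T1 to H. *)
Lemma triangular_extension_concave H M (J : 'B(H, M)) (T : 'B(H)) (T1 : 'B(M)) :
  triangular_extension J T T1 ->
  [/\ concave T, concave T1 & sqrt_norm_Delta T1 = sqrt_norm_Delta T].
Proof.
move=> [JT [M0 [M1 [J0 [J1 [V [E1 [W [JJ [T1E [VV WW /contractiveP E1c VE /ople_adjP EW]]]]]]]]]]].
have cT1 := triangular_concave JJ T1E VV WW VE EW.
have cT := extension_concave JT cT1.
split=> //; congr Num.sqrt; apply/eqP; rewrite eq_le; apply/andP; split.
  by rewrite -(sqr_sqrt_norm_Delta T); exact: (triangular_opnorm JJ T1E VV WW VE E1c).
have [JI _] := JT; apply: (opnorm_Delta_le JI cT) => h.
rewrite !Delta_rdot; have := extension_iter 1 h JT; have := extension_iter 0 h JT.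
by rewrite /= => -> ->.
Qed.

(** The entries of the extension, together with the components a and b of the
    embedding of H. The last clause reduces the convergence of E1 W^n to vectors of
    the range of b; on these, delta E1 W^n b h has the norm of Delta_T^(1/2) T^n h.
    The space M1 is that of the dilation of a contraction of H, and M0 that of the
    dilation of a contraction of H + H. *)
Lemma triangular_model H (T : 'B(H)) : concave T ->
  exists (M0 M1 : hilbertType R) (V : 'B(M0)) (E1 : 'B(M1, M0)) (W : 'B(M1))
         (a : 'B(H, M0)) (b : 'B(H, M1)),
  [/\ isometric V, isometric W, forall y, nsq (E1 y) <= nsq y,
      forall y, adjoint V (E1 y) = 0 & forall y, nsq (E1 (W y)) <= nsq (E1 y)] /\
  [/\ forall h, nsq (a h) + nsq (b h) = nsq h,
      forall h, V (a h) + (sqrt_norm_Delta T)%:C *: E1 (b h) = a (T h),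
      forall h, W (b h) = b (T h)
    & (forall h, (fun n => nsq (E1 (iter n W (b h)))) @ \oo --> (0 : R)) ->
      forall y, (fun n => nsq (E1 (iter n W y))) @ \oo --> (0 : R)].
Proof.
move=> cT; have [Q [sQ pQ Q1 QT QD]] := concave_majorant cT.
pose d := sqrt_norm_Delta T; have d0 : 0 <= d := sqrt_norm_Delta_ge0 T.
rewrite -sqr_sqrt_norm_Delta -/d in QD.
have [b0 _ b0E] := sqrt_form sQ pQ.
pose A := badd (bscale H 1) (bcomp (bscale H (-1)) Q).
have AE x : rdot (A x) x = nsq x - rdot (Q x) x by rewrite !bopE !rdotE; ring.
have [||a0 _ a0E] := @sqrt_form _ _ A.
- by apply: selfadj_badd; [exact: selfadj_bscale|exact: selfadj_bscaleM].
- by move=> x; rewrite AE subr_ge0.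
have {}a0E x : nsq (a0 x) = nsq x - rdot (Q x) x by rewrite a0E AE.
have [D _ DE] := sqrt_form (bDelta_selfadj T) (bDelta_psd cT).
have {}DE x : nsq (D x) = nsq (T x) - nsq x by rewrite DE bDelta_rdot.
have Dd x : nsq (D x) <= d ^+ 2 * rdot (Q x) x.
  by rewrite DE -Delta_rdot QD.
(* The invariance of Q makes b0 h |-> b0 (T h) isometric, and the bound [Dd] makes
   b0 h |-> d^-1 D h contractive. Both extensions vanish on the orthogonal of the
   range of b0, which allows them to be compared on all of H. *)
have [|G [GE G1 G0]] := @douglas _ _ _ _ (bcomp b0 T) b0.
  by move=> h; rewrite bcompE !b0E QT.
have [|E0 [E0E E01 E00]] := @douglas _ _ _ _ (bcomp (bscale H d^-1) D) b0.
  move=> h; rewrite !bopE !rdotE b0E; have [->|dn] := eqVneq d 0.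
    by rewrite invr0 mul0r; exact: pQ.
  rewrite mulrA -expr2 exprVn ler_pdivrMl ?Dd// exprn_gt0//.
  by rewrite lt_def dn.
have dE0 h : d%:C *: E0 (b0 h) = D h.
  rewrite E0E !bopE scalerA -rmorphM; have [d00|dn] := eqVneq d 0; last first.
    by rewrite divff// rmorph1 scale1r.
  rewrite d00 mul0r rmorph0 scale0r; apply/esym/nsq_eq0/eqP.
  by rewrite eq_le nsq_ge0 andbT; have := Dd h; rewrite d00 expr0n mul0r.
have [W [WW Whd WE]] := isometric_dilation G1.
have Wb h : W (lemb H (b0 h)) = lemb H (b0 (T h)).
  by rewrite WE ?GE// bcompE !b0E QT.
(* (a0 h, D h) |-> a0 (T h) preserves norms since
   |a0 (T h)|^2 = |T h|^2 - <Q h, h> = |a0 h|^2 + |D h|^2. *)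
pose P := dsum H H.
pose l := dinl H H; pose r := dinr H H.
pose B : 'B(H, P) := badd (bcomp l a0) (bcomp r D).
have BE h : nsq (B h) = nsq (T h) - rdot (Q h) h.
  rewrite !bopE !rdotE !dinl_rdot !dinr_rdot (rdotC (r _)) !dinlr_rdot a0E DE; ring.
have aTE h : nsq (bcomp l (bcomp a0 T) h) = nsq (B h).
  by rewrite !bopE dinl_rdot a0E QT BE.
have [h|G' [G'E G'1 _]] := @douglas _ _ _ _ (bcomp l (bcomp a0 T)) B.
  by rewrite aTE.
have [W' [W'W _ W'E]] := isometric_dilation G'1.
pose p : 'B(P) := bcomp l (bfst H H).
(* The dilation W' starts from sequences in H + H. Its restriction to the sequences
   whose first entry lies in H + 0 becomes an operator V on the whole space by
   composition with the isometric dilation Wp of the projection onto H + 0, and the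
   sequences (0 + x, 0, 0, ...) are left for the range of E1. *)
have [|Wp [WpW Wphd WpE]] := @isometric_dilation _ _ p.
  by move=> z; rewrite bcompE dinl_rdot -[leRHS]mul1r; exact: dfst_bounded.
have pl x : p (l x) = l x by [].
pose iota : 'B(H, l2 P) := bcomp W' (bcomp (lemb P) r).
have iotaE x : nsq (iota x) = nsq x.
  by rewrite !bopE (isometric_rdot _ _ W'W) lemb_rdot lhead_cons dinr_rdot.
pose E1 : 'B(l2 H, l2 P) := bcomp iota (bcomp E0 (bhead H)).
have E1E y : nsq (E1 y) = nsq (E0 (lhead y)) by rewrite bcompE iotaE.
(* Concavity gives |D (T h)| <= |D h|, that is the inequality on the range of b0;
   both sides vanish on its orthogonal. *)
have E0G k : nsq (E0 (G k)) <= nsq (E0 k).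
  have [u [q [-> [v vu] q0]]] := orth_decomp b0 k.
  rewrite !linearD (G0 q q0) (E00 q q0) linear0 !addr0.
  have c1 := nsq_cvg (tendsto_bop E0 (tendsto_bop G vu)).
  apply: (ler_cvg_to c1 (nsq_cvg (tendsto_bop E0 vu))); near=> n.
  rewrite GE bcompE !E0E !bopE !rdotE !ler_wpM2l ?invr_ge0// !DE.
  by have := (concaveP T).1 cT (v n); lra.
have iterhd n y : lhead (iter n W y) = iter n G (lhead y).
  by elim: n => //= n <-; rewrite Whd.
exists (l2 P), (l2 H), (bcomp W' Wp), E1, W.
exists (bcomp (lemb P) (bcomp l a0)), (bcomp (lemb H) b0); split; split.
- by apply: isometricP => x; rewrite bcompE (isometric_rdot _ _ W'W) (isometric_rdot _ _ WpW).
- exact: WW.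
- by move=> y; rewrite E1E (le_trans (E01 _))// -[leRHS]mul1r; exact: lhead_bounded.
- move=> y; apply: rdot_ext => z; rewrite rdot0r rdot_adj !bopE.
  by rewrite (isometric_rdot _ _ W'W) rdotC lemb_rdot Wphd rdotC dinlr_rdot.
- by move=> y; rewrite !E1E Whd.
- move=> h; rewrite !bopE !lemb_rdot !lhead_cons dinl_rdot a0E b0E; ring.
- move=> h; rewrite !bopE (WpE (l (a0 h))) ?pl// -!linearZ -!linearD.
  have -> : E0 (bhead H (lemb H (b0 (d%:C *: h)))) = D h by rewrite -dE0 -!linearZ.
  by rewrite (W'E (B h)) G'E// aTE.
- exact: Wb.
- move=> hb y.
  have {}hb h : (fun n => nsq (E0 (iter n G (b0 h)))) @ \oo --> (0 : R).
    have := hb h; rewrite (_ : (fun n => _) = fun n => nsq (E0 (iter n G (b0 h))))//.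
    by apply/funext => n; rewrite E1E iterhd.
  rewrite (_ : (fun n => _) = fun n => nsq (E0 (iter n G (lhead y)))); last first.
    by apply/funext => n; rewrite E1E iterhd.
  have [u [q [-> [v vu] q0]]] := orth_decomp b0 (lhead y).
  (* only the component u in the closure of the range of b0 matters, and it is
     approximated by b0 (v N) uniformly in n because E0 G^n is contractive *)
  have iterD n z : iter n G (z + q) - iter n G z = (if n is 0%N then q else 0).
    elim: n => [|n IH]; first by rewrite addrC addKr.
    by rewrite /= -linearB IH; case: (n) => [|_]; [exact: G0|exact: linear0].
  have E0D n z : E0 (iter n G (z + q)) = E0 (iter n G z).
    apply: subr0_eq; rewrite -linearB iterD; case: n => [|n]; last exact: linear0.
    exact: E00.
  have iterB n z z' : nsq (iter n G (z - z')) <= nsq (z - z').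
    by elim: n => //= n; apply: le_trans; exact: G1.
  have iterDG n z z' : iter n G (z + z') = iter n G z + iter n G z'.
    by elim: n => //= n ->; rewrite linearD.
  apply/cvgrPdist_lt => e e0; have e4 : 0 < e / 4 by rewrite divr_gt0.
  have [N HN] := (tendsto_ltP _ _).1 vu _ e4.
  have /cvgrPdist_lt/(_ _ e4) := hb (v N); apply: filterS => n.
  rewrite !sub0r !normrN !ger0_norm ?nsq_ge0// E0D => hn.
  rewrite -[u](subrK (b0 (v N))) iterDG linearD.
  apply: (le_lt_trans (nsqD_le _ _)).
  have := HN _ (leqnn N); rewrite nsqB.
  have := iterB n u (b0 (v N)); have := E01 (iter n G (u - b0 (v N))); lra.
Unshelve. all: by end_near. Qed.

End Extension.

(** * Asymptotic behaviour of the powers *)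

Section Asymptotics.
Variable R : realType.
Implicit Types H K M : hilbertType R.

Lemma selfadj_inner H (A : 'B(H)) x : selfadj A -> '[A x, x] = (rdot (A x) x)%:C.
Proof.
move=> sA; apply: inner_real.
have [_ h] : rdot x (A x) = rdot x (A x) /\ rdot x ('i *: A x) = - rdot ('i *: x) (A x).
  by split=> //; have := innerE x (A x); rewrite innerEl => -[->].
have := sA x ('i *: x); rewrite linearZ /= h (rdotC ('i *: x)); lra.
Qed.

(** The root selected by [psqrt] is self-adjoint by [ople0_psd]. *)
Lemma psqrt_nsq H (A : 'B(H)) x : selfadj A -> psd A ->
  nsq (psqrt A x) = rdot (A x) x.
Proof.
move=> sA pA; have [Z [sZ pZ ZZ]] := sqrt_op sA pA.
suff: [set B : H -> H | [/\ linear B, continuous B, ople (fun=> 0) B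
    & forall x, B (B x) = A x]] (psqrt A).
  by move=> [lB _ /(ople0_psd lB)[sB _] BB]; rewrite -BB [RHS]sB.
apply: (@getI _ _ (Z : H -> H)); split.
- exact: linearP.
- exact: bop_continuous.
- move=> y; rewrite (selfadj_inner y sZ) inner_real ?rdot0l//.
  by rewrite lecR.
- exact: ZZ.
Qed.

Lemma strongly_cvg0P H K (A : nat -> H -> K) :
  strongly_cvg0 A <-> forall x, (fun n => nsq (A n x)) @ \oo --> (0 : R).
Proof.
have E x : tendsto (fun n => A n x) 0 = ((fun n => nsq (A n x)) @ \oo --> (0 : R)).
  rewrite /tendsto (_ : (fun n => nsq (A n x - 0)) = fun n => nsq (A n x)) //.
  by apply/funext => n; rewrite subr0.
by split=> h x; [rewrite -E; apply/tendstoP|apply/tendstoP; rewrite E]; exact: h.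
Qed.

(** For a concave T this is the squared norm of Delta_T^(1/2) T^n x. In this form it
    telescopes, and it is the same for T and for an extension of T. *)
Definition growth H (T : H -> H) (x : H) (n : nat) : R :=
  nsq (iter n.+1 T x) - nsq (iter n T x).

Lemma Delta_sqrt_iter_cvg0 H (T : 'B(H)) : concave T ->
  strongly_cvg0 (Delta_sqrt_iter T) <-> forall x, growth T x @ \oo --> (0 : R).
Proof.
move=> cT; rewrite strongly_cvg0P.
have E x : (fun n => nsq (Delta_sqrt_iter T n x)) = growth T x.
  apply/funext => n; rewrite /Delta_sqrt_iter.
  rewrite (psqrt_nsq _ (bDelta_selfadj T) (bDelta_psd cT)).
  by rewrite bDelta_rdot.
by split=> h x; have := h x; rewrite E.
Qed.

Lemma scaled_iter_nsq H (T : 'B(H)) n x :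
  nsq (scaled_iter T n x) = n%:R^-1 * nsq (iter n T x).
Proof.
have : `|(sqrtC n%:R)^-1 : R[i]| ^+ 2 = (n%:R^-1)%:C.
  rewrite normfV ger0_norm ?sqrtC_ge0// exprVn sqrtCK.
  by rewrite fmorphV rmorph_nat.
rewrite normRe -rmorphXn => /complexI aE.
by rewrite /scaled_iter nsqZ aE.
Qed.

(** |T^n x|^2 is |x|^2 plus the sum of the first n terms of the growth, so Cesaro's
    lemma applies. *)
Lemma scaled_iter_cvg0 H (T : 'B(H)) : (forall x, growth T x @ \oo --> (0 : R)) ->
  strongly_cvg0 (scaled_iter T).
Proof.
move=> gT; apply/strongly_cvg0P => x.
rewrite -(cvg_shiftS (fun n => nsq (scaled_iter T n x))).
have sumE n : series (growth T x) n = nsq (iter n T x) - nsq x.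
  by rewrite /series /= telescope_sumr.
rewrite (_ : (fun n => _) = fun n => arithmetic_mean (growth T x) n + n.+1%:R^-1 * nsq x).
  have c1 : arithmetic_mean (growth T x) @ \oo --> (0 : R) := cesaro (gT x).
  have c2 : (fun n => n.+1%:R^-1 * nsq x) @ \oo --> (0 : R).
    rewrite -[0 in X in _ --> X](mul0r (nsq x)).
    by apply: cvgM; [exact: cvg_harmonic|exact: cvg_cst].
  by have := cvgD c1 c2; rewrite addr0; exact.
by apply/funext => n; rewrite scaled_iter_nsq /arithmetic_mean /= sumE; ring.
Qed.

Lemma extension_growth H M (J : 'B(H, M)) (T : 'B(H)) (T1 : 'B(M)) h :
  extension J T T1 -> growth T1 (J h) = growth T h.
Proof.
by move=> JT; apply/funext => n; rewrite /growth !(extension_iter _ _ JT).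
Qed.

(** By [triangular_growth] the growth of T1 only involves the component in M1, and the
    last clause of [triangular_model] reduces it to the embedded vectors, where it is
    the growth of T. *)
Lemma concave_triangular_extension H (T : 'B(H)) : concave T ->
  exists (M : hilbertType R) (J : 'B(H, M)) (T1 : 'B(M)),
    triangular_extension J T T1 /\
    ((forall h, growth T h @ \oo --> (0 : R)) ->
     (forall z, growth T1 z @ \oo --> (0 : R))).
Proof.
move=> cT; have [M0 [M1 [V [E1 [W [a [b [[VV WW E1c VE EW] [ab Ta Tb dense]]]]]]]]] :=
  triangular_model cT.
pose d := sqrt_norm_Delta T; rewrite -/d in Ta.
have JJ := dsum_orthogonal_sum M0 M1.
pose J := badd (bcomp (dinl M0 M1) a) (bcomp (dinr M0 M1) b).
pose T1 := badd
  (bcomp (dinl M0 M1) (badd (bcomp V (bfst M0 M1))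
                            (bcomp (bscale M0 d) (bcomp E1 (bsnd M0 M1)))))
  (bcomp (dinr M0 M1) (bcomp W (bsnd M0 M1))).
have T1E x y : T1 (dinl M0 M1 x + dinr M0 M1 y) =
    dinl M0 M1 (V x + d%:C *: E1 y) + dinr M0 M1 (W y).
  by rewrite /T1 !bopE bfstK bsndK.
have JT : extension J T T1.
  split; last by move=> h; rewrite T1E Ta Tb.
  by apply: isometricP => h; rewrite (orthogonal_sum_nsq JJ) ab.
exists (dsum M0 M1), J, T1; split.
  split=> //; exists M0, M1, (dinl M0 M1), (dinr M0 M1), V, E1, W; split=> //.
  by split=> //; split=> //; [exact/contractiveP|exact/ople_adjP].
move=> gT z; have [x [y ->]] : exists x y, z = dinl M0 M1 x + dinr M0 M1 y.
  by have [_ _ _] := JJ; apply.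
have gE u v : growth T1 (dinl M0 M1 u + dinr M0 M1 v) =
    fun n => d ^+ 2 * nsq (E1 (iter n W v)).
  by apply/funext => n; rewrite /growth (triangular_growth JJ T1E VV WW VE).
rewrite gE; have [->|d0] := eqVneq d 0.
  rewrite (_ : (fun n => _) = fun=> 0); first exact: cvg_cst.
  by apply/funext => n; rewrite expr0n mul0r.
rewrite -[0 in X in _ --> X](mulr0 (d ^+ 2)).
apply: cvgM; first exact: cvg_cst.
apply: dense => h; have := gT h; rewrite -(extension_growth h JT) gE => gh.
rewrite (_ : (fun n => _) = fun n => d ^- 2 * (d ^+ 2 * nsq (E1 (iter n W (b h))))).
  rewrite -[0 in X in _ --> X](mulr0 (d ^- 2)).
  by apply: cvgM; [exact: cvg_cst|exact: gh].
by apply/funext => n; rewrite mulKf// expf_neq0.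
Qed.

End Asymptotics.

Theorem theorem3p10 (R : realType) (H : hilbertType R) (T : 'B(H)) :
  (* (i) *)
  ((concave T <->
      exists (M : hilbertType R) (J : 'B(H, M)) (T1 : 'B(M)),
        triangular_extension J T T1) /\
   (forall (M : hilbertType R) (J : 'B(H, M)) (T1 : 'B(M)),
      triangular_extension J T T1 ->
      concave T1 /\ sqrt_norm_Delta T1 = sqrt_norm_Delta T)) /\
  (* (ii) *)
  (concave T ->
     exists (M : hilbertType R) (J : 'B(H, M)) (T1 : 'B(M)),
       triangular_extension J T T1 /\
       (strongly_cvg0 (Delta_sqrt_iter T) \/
        strongly_cvg0 (Delta_sqrt_iter T1) ->
        [/\ strongly_cvg0 (Delta_sqrt_iter T),
            strongly_cvg0 (Delta_sqrt_iter T1),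
            strongly_cvg0 (scaled_iter T)
          & strongly_cvg0 (scaled_iter T1)])) /\
  (* (iii) *)
  (concave T ->
     exists (K : hilbertType R) (J : 'B(H, K)) (S : 'B(K)),
       [/\ lifting J T S, two_isometry S, minimal_lifting J S, type_I J S
         & sqrt_norm_Delta S = sqrt_norm_Delta T]).
Proof.
split; [split; [split|]|split].
- by move=> /concave_triangular_extension[M [J [T1 [tri _]]]]; exists M, J, T1.
- by move=> [M [J [T1 /triangular_extension_concave[]]]].
- by move=> M J T1 /triangular_extension_concave[].
- move=> cT; have [M [J [T1 [tri gTT1]]]] := concave_triangular_extension cT.
  exists M, J, T1; split=> //.
  have [_ cT1 _] := triangular_extension_concave tri; have [JT _] := tri.
  have [to_growth of_growth] := Delta_sqrt_iter_cvg0 cT.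
  have [to_growth1 of_growth1] := Delta_sqrt_iter_cvg0 cT1.
  move=> g; have gT : forall h, growth T h @ \oo --> (0 : R).
    case: g => [/to_growth//|/to_growth1 g h].
    by rewrite -(extension_growth h JT); exact: g.
  have gT1 := gTT1 gT.
  split; [exact: of_growth|exact: of_growth1|exact: scaled_iter_cvg0..].
- exact: concave_lifting.
Qed.
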